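(* Let $P \in \mathbb{P}$. Then for every formula $\phi$ of event identifier logic and every environment $\rho$ permissible for $X_P$ and $\phi$, $P \models_\rho \phi$ (satisfaction over processes) if and only if $[\![P]\!] \models_\rho \phi$, i.e., $X_P \models_\rho \phi$ in the configuration structure $\mathsf{C}_P$.
   Context: Processes, proof terms, $\mathrm{act}$, proved transitions and $\mathbb{P}$: fix a countable set $\mathcal{A}$ of actions containing $\tau$; proof terms $\theta ::= a \mid ._{a}\theta \mid {+_{\mathrm l}}\theta \mid {+_{\mathrm r}}\theta \mid {\|^{\mathrm l}_{L}}\theta \mid {\|^{\mathrm r}_{L}}\theta \mid \langle\theta,\theta\rangle_L$; $\mathrm{act}(\theta)$ extracts the action ($\mathrm{act}(a)=a$, unary constructors transparent, $\mathrm{act}(\langle\theta_1,\theta_2\rangle_L)=\mathrm{act}(\theta_1)$ if equal to $\mathrm{act}(\theta_2)$, undefined otherwise). Processes $P ::= \underline{0} \mid a.P \mid a^{\dagger\xi}.P \mid P + P \mid P \|_L P$, $\xi ::= \varepsilon \mid \langle\theta,\theta'\rangle_L$ ($a^\dagger=a^{\dagger\varepsilon}$); initial processes contain no $\dagger$; $\mathrm{toinitial}(P)$ replaces each $a^{\dagger\xi}$ by $a$. Proved transitions: (Act$_f$) $P$ initial implies $a.P\xrightarrow{a}a^\dagger.P$; (Act$_p$) $P\xrightarrow{\theta}P'$ implies $a^{\dagger\xi}.P\xrightarrow{._a\theta}a^{\dagger\xi}.P'$; (Cho$_{l/r}$) the moving summand $P_i\xrightarrow{\theta}P_i'$ with the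 other summand initial gives $P_1+P_2\xrightarrow{+_{\mathrm l}\theta}P_1'+P_2$ resp. $\xrightarrow{+_{\mathrm r}\theta}P_1+P_2'$; (Par$_{l/r}$) $P_i\xrightarrow{\theta}P_i'$, $\mathrm{act}(\theta)\notin L$ gives $P_1\|_LP_2\xrightarrow{\|^{\mathrm l}_L\theta}P_1'\|_LP_2$ resp. $\xrightarrow{\|^{\mathrm r}_L\theta}P_1\|_LP_2'$; (Syn) $P_1\xrightarrow{\theta_1}P_1'$, $P_2\xrightarrow{\theta_2}P_2'$, $\mathrm{act}(\theta_1)=\mathrm{act}(\theta_2)\in L$ gives $P_1\|_LP_2\xrightarrow{\langle\theta_1,\theta_2\rangle_L}\mathrm{enr}(P_1'\|_LP_2',\langle\theta_1,\theta_2\rangle_L)$, where $\mathrm{enr}(P,\bar\theta)=\mathrm{enr}'(P,\bar\theta,\bar\theta)$: $\mathrm{enr}'(\underline0,\theta,\bar\theta)=\underline0$, $\mathrm{enr}'(a^{\dagger\xi}.P',a,\bar\theta)=a^{\dagger\bar\theta}.P'$, $\mathrm{enr}'(a^{\dagger\xi}.P',._a\theta',\bar\theta)=a^{\dagger\xi}.\mathrm{enr}'(P',\theta',\bar\theta)$, $\mathrm{enr}'$ descends into the left/right summand or parallel component as indicated by $+_{\mathrm l},+_{\mathrm r},\|^{\mathrm l}_L,\|^{\mathrm r}_L$, and $\mathrm{enr}'(P_1\|_LP_2,\langle\theta_1,\theta_2\rangle_L,\bar\theta)=\mathrm{enr}'(P_1,\theta_1,\bar\theta)\|_L\mathrm{enr}'(P_2,\theta_2,\bar\theta)$.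 $\mathbb{P}$ is the set of processes reachable from initial processes. Denotational semantics: stable configuration structures $(\mathcal{E},\mathcal{C},\ell)$ with events being proof terms and $\ell(e)=\mathrm{act}(e)$; transitions $X\xrightarrow{a}X'$ iff $X\subseteq X'$, $X'\setminus X=\{e\}$, $\ell(e)=a$. $\mathsf{N}=(\emptyset,\{\emptyset\},\emptyset)$; $a.\mathsf{C}$: events $\{a\}\cup\{._a\theta\mid\theta\in\mathcal{E}\}$, configurations $\{\emptyset\}\cup\{\{a\}\cup\{._a\theta\mid\theta\in X\}\mid X\in\mathcal{C}\}$; $\mathsf{C}_1+\mathsf{C}_2$: configurations $\{+_{\mathrm l}\theta\mid\theta\in X_1\}$ for $X_1\in\mathcal{C}_1$ and $\{+_{\mathrm r}\theta\mid\theta\in X_2\}$ for $X_2\in\mathcal{C}_2$; $\mathsf{C}_1\|_L\mathsf{C}_2$: events $\|^{\mathrm l}_L\theta$ ($\theta\in\mathcal{E}_1$, $\mathrm{act}(\theta)\notin L$), $\|^{\mathrm r}_L\theta$ ($\theta\in\mathcal{E}_2$, $\mathrm{act}(\theta)\notin L$), $\langle\theta_1,\theta_2\rangle_L$ ($\theta_i\in\mathcal{E}_i$, $\mathrm{act}(\theta_1)=\mathrm{act}(\theta_2)\in L$); configurations the finite sets $X$ of such events with $\mathrm{proj}_i(X)\in\mathcal{C}_i$ (where $\mathrm{proj}_1(X)=\{\theta_1\mid\|^{\mathrm l}_L\theta_1\in X\text{ or }\exists\theta_2.\langle\theta_1,\theta_2\rangle_L\in X\}$, $\mathrm{proj}_2$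 symmetric), such that for all $e,e'\in X$, equal nonempty projection $\mathrm{proj}_1(\{e\})=\mathrm{proj}_1(\{e'\})$ or $\mathrm{proj}_2(\{e\})=\mathrm{proj}_2(\{e'\})$ implies $e=e'$, and $e\ne e'$ implies some $Y\subseteq X$ with $\mathrm{proj}_i(Y)\in\mathcal{C}_i$ contains exactly one of $e,e'$. $\mathrm{scs}$ maps initial processes homomorphically onto these operators ($\underline0\mapsto\mathsf{N}$). For $P\in\mathbb{P}$, $[\![P]\!]=(\mathsf{C}_P,X_P)$ with $\mathsf{C}_P=\mathrm{scs}(\mathrm{toinitial}(P))$ and $X_P$ the set of proof terms labeling a sequence of proved transitions from $\mathrm{toinitial}(P)$ to $P$ ($\emptyset$ if $P$ initial). Event identifier logic: with a countable set $\mathrm{Id}$ of identifiers, $\phi ::= \mathrm{true}\mid\neg\phi\mid\phi\wedge\phi\mid\langle x:a\rangle\phi\mid(x:a)\phi\mid\langle\!\langle x\rangle\!\rangle\phi$. Free identifiers: $\mathrm{fid}(\mathrm{true})=\emptyset$, $\mathrm{fid}$ of $\neg,\wedge$ as usual, $\mathrm{fid}(\langle x:a\rangle\phi)=\mathrm{fid}((x:a)\phi)=\mathrm{fid}(\phi)\setminus\{x\}$, $\mathrm{fid}(\langle\!\langle x\rangle\!\rangle\phi)=\mathrm{fid}(\phi)\cup\{x\}$. An environment is a partial function $\rho:\mathrm{Id}\rightharpoonup$ events (proof terms); $\rho$ is permissible for a configuration $X$ and $\phi$ iff $\mathrm{fid}(\phi)\subseteq\mathrm{dom}(\rho)$ and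 $\rho$ maps $\mathrm{fid}(\phi)$ into $X$. $\rho[x\mapsto e]$ is $\rho$ updated at $x$. Satisfaction in a configuration structure (environments always permissible): $X\models_\rho\mathrm{true}$; $\neg,\wedge$ as usual; $X\models_\rho\langle x:a\rangle\phi'$ iff there is $X\xrightarrow{\ell(e)}X'$ with $\ell(e)=a$ and $X'\models_{\rho[x\mapsto e]}\phi'$; $X\models_\rho(x:a)\phi'$ iff there is $e\in X$ with $\ell(e)=a$ and $X\models_{\rho[x\mapsto e]}\phi'$; $X\models_\rho\langle\!\langle x\rangle\!\rangle\phi'$ iff there is $X'\xrightarrow{\ell(e)}X$ with $\rho(x)=e$ and $X'\models_\rho\phi'$. Satisfaction over processes (environments permissible for $X_P$ and the formula): $\mathrm{true}$, $\neg$, $\wedge$ as usual; $P\models_\rho\langle x:a\rangle\phi'$ iff there is $P\xrightarrow{\theta}P'$ with $\mathrm{act}(\theta)=a$ and $P'\models_{\rho[x\mapsto\theta]}\phi'$; $P\models_\rho(x:a)\phi'$ iff there is a subprocess $a^\dagger.P'$ of $P$ with $P\models_{\rho[x\mapsto\mathrm{apt}(a^\dagger.P',P)]}\phi'$; $P\models_\rho\langle\!\langle x\rangle\!\rangle\phi'$ iff there is $P'\xrightarrow{\theta}P$ with $\rho(x)=\theta$ and $P'\models_\rho\phi'$. Here $\mathrm{apt}(a^\dagger.P',P)=\theta$ iff $a^\dagger.P'$ is a subprocess of $P$ and there are processes $P'',P'''$ with $a.\mathrm{toinitial}(P')$ a subprocess of $P''$, $P''\xrightarrow{\theta}P'''$,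 $\mathrm{act}(\theta)=a$, and $a^\dagger.\mathrm{toinitial}(P')$ a subprocess of $P'''$.
   Formalization: In the clause for (x:a) and in apt, the executed action may carry any superscript ξ, not only ε (with ε alone the claim fails after a synchronization), and apt, which is not single-valued, is read as a relation: some value θ of it keeping the environment permissible is used. *)

(* Defs.v *)
From Stdlib Require List.
From mathcomp Require Import all_boot.
From mathcomp Require Import boolp classical_sets functions cardinality.

Set Implicit Arguments.
Unset Strict Implicit.
Unset Printing Implicit Defensive.

Local Open Scope classical_set_scope.

Section Terms.
Variable A : countType.

(* [TPre a t] is the term ._a t, [TSync L t1 t2] is <t1, t2>_L. *)
Inductive pterm : Type :=
  | TAct of A
  | TPre of A & pterm
  | TPlusL of pterm
  | TPlusR of pterm
  | TParL of set A & pterm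
  | TParR of set A & pterm
  | TSync of set A & pterm & pterm.

Fixpoint act (t : pterm) : option A :=
  match t with
  | TAct a => Some a
  | TPre _ t' | TPlusL t' | TPlusR t' | TParL _ t' | TParR _ t' => act t'
  | TSync _ t1 t2 => if act t1 == act t2 then act t1 else None
  end.

(* The superscript xi of an executed action. *)
Inductive mark : Type :=
  | MEps
  | MSync of set A & pterm & pterm.

(* [Past a xi P] is the process a^{dagger xi} followed by P. *)
Inductive proc : Type :=
  | Null
  | Pre of A & proc
  | Past of A & mark & proc
  | Sum of proc & proc
  | Par of set A & proc & proc.

Fixpoint initial (P : proc) : Prop :=
  match P with
  | Null => True
  | Pre _ P' => initial P'
  | Past _ _ _ => False
  | Sum P1 P2 | Par _ P1 P2 => initial P1 /\ initial P2
  end.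

Fixpoint toinitial (P : proc) : proc :=
  match P with
  | Null => Null
  | Pre a P' | Past a _ P' => Pre a (toinitial P')
  | Sum P1 P2 => Sum (toinitial P1) (toinitial P2)
  | Par L P1 P2 => Par L (toinitial P1) (toinitial P2)
  end.

(* [subproc Q P]: Q is a (not necessarily proper) subterm of P. *)
Fixpoint subproc (Q P : proc) : Prop :=
  Q = P \/
  match P with
  | Null => False
  | Pre _ P' | Past _ _ P' => subproc Q P'
  | Sum P1 P2 | Par _ P1 P2 => subproc Q P1 \/ subproc Q P2
  end.

(* [enr_rec P t xi Q] is the graph of the partial function enr':
   enr'(P, t, xi) = Q, where xi is the synchronization being recorded. *)
Inductive enr_rec : proc -> pterm -> mark -> proc -> Prop :=
  | enr_nil t xi : enr_rec Null t xi Null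
  | enr_act a xi0 P xi : enr_rec (Past a xi0 P) (TAct a) xi (Past a xi P)
  | enr_pre a xi0 P t xi Q :
      enr_rec P t xi Q ->
      enr_rec (Past a xi0 P) (TPre a t) xi (Past a xi0 Q)
  | enr_plusl P1 P2 t xi Q1 :
      enr_rec P1 t xi Q1 -> enr_rec (Sum P1 P2) (TPlusL t) xi (Sum Q1 P2)
  | enr_plusr P1 P2 t xi Q2 :
      enr_rec P2 t xi Q2 -> enr_rec (Sum P1 P2) (TPlusR t) xi (Sum P1 Q2)
  | enr_parl L P1 P2 t xi Q1 :
      enr_rec P1 t xi Q1 -> enr_rec (Par L P1 P2) (TParL L t) xi (Par L Q1 P2)
  | enr_parr L P1 P2 t xi Q2 :
      enr_rec P2 t xi Q2 -> enr_rec (Par L P1 P2) (TParR L t) xi (Par L P1 Q2)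
  | enr_sync L P1 P2 t1 t2 xi Q1 Q2 :
      enr_rec P1 t1 xi Q1 -> enr_rec P2 t2 xi Q2 ->
      enr_rec (Par L P1 P2) (TSync L t1 t2) xi (Par L Q1 Q2).

Definition enr (P : proc) (L : set A) (t1 t2 : pterm) (Q : proc) : Prop :=
  enr_rec P (TSync L t1 t2) (MSync L t1 t2) Q.

Inductive trans : proc -> pterm -> proc -> Prop :=
  | tr_actf a P : initial P -> trans (Pre a P) (TAct a) (Past a MEps P)
  | tr_actp a xi P t P' :
      trans P t P' -> trans (Past a xi P) (TPre a t) (Past a xi P')
  | tr_chol P1 P2 t P1' :
      trans P1 t P1' -> initial P2 -> trans (Sum P1 P2) (TPlusL t) (Sum P1' P2)
  | tr_chor P1 P2 t P2' :
      trans P2 t P2' -> initial P1 -> trans (Sum P1 P2) (TPlusR t) (Sum P1 P2')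
  | tr_parl L P1 P2 t a P1' :
      trans P1 t P1' -> act t = Some a -> ~ L a ->
      trans (Par L P1 P2) (TParL L t) (Par L P1' P2)
  | tr_parr L P1 P2 t a P2' :
      trans P2 t P2' -> act t = Some a -> ~ L a ->
      trans (Par L P1 P2) (TParR L t) (Par L P1 P2')
  | tr_syn L P1 P2 t1 t2 a P1' P2' Q :
      trans P1 t1 P1' -> trans P2 t2 P2' ->
      act t1 = Some a -> act t2 = Some a -> L a ->
      enr (Par L P1' P2') L t1 t2 Q ->
      trans (Par L P1 P2) (TSync L t1 t2) Q.

Inductive steps : proc -> seq pterm -> proc -> Prop :=
  | steps_nil P : steps P [::] P
  | steps_cons P t P' s Q :
      trans P t P' -> steps P' s Q -> steps P (t :: s) Q.

(* Membership in the set of processes reachable from an initial one. *)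
Definition reachable (P : proc) : Prop :=
  exists (P0 : proc) (s : seq pterm), initial P0 /\ steps P0 s P.

(* Events are proof terms and the labelling is always [act], so only events
   and configurations are recorded. *)
Record cstruct := CStruct {
  events : set pterm;
  configs : set (set pterm) }.

Definition cs_nil : cstruct := CStruct set0 [set set0].

Definition cs_pre (a : A) (C : cstruct) : cstruct :=
  CStruct ([set TAct a] `|` TPre a @` events C)
          ([set set0] `|`
           [set [set TAct a] `|` TPre a @` X | X in configs C]).

Definition cs_sum (C1 C2 : cstruct) : cstruct :=
  CStruct (TPlusL @` events C1 `|` TPlusR @` events C2)
          ([set TPlusL @` X | X in configs C1] `|`
           [set TPlusR @` X | X in configs C2]).

Definition proj_1 (L : set A) (X : set pterm) : set pterm :=
  [set t1 | X (TParL L t1) \/ exists t2, X (TSync L t1 t2)].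

Definition proj_2 (L : set A) (X : set pterm) : set pterm :=
  [set t2 | X (TParR L t2) \/ exists t1, X (TSync L t1 t2)].

Definition par_events (L : set A) (E1 E2 : set pterm) : set pterm :=
  [set TParL L t | t in
     [set t | E1 t /\ exists a, act t = Some a /\ ~ L a]] `|`
  [set TParR L t | t in
     [set t | E2 t /\ exists a, act t = Some a /\ ~ L a]] `|`
  [set e | exists t1 t2, [/\ e = TSync L t1 t2, E1 t1, E2 t2 &
     exists a, [/\ act t1 = Some a, act t2 = Some a & L a]]].

Definition par_config (L : set A) (C1 C2 : cstruct) (X : set pterm) : Prop :=
  [/\ X `<=` par_events L (events C1) (events C2) /\ finite_set X,
      configs C1 (proj_1 L X) /\ configs C2 (proj_2 L X),
      forall e e', X e -> X e' ->
        (proj_1 L [set e] = proj_1 L [set e'] /\ proj_1 L [set e] !=set0) \/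
        (proj_2 L [set e] = proj_2 L [set e'] /\ proj_2 L [set e] !=set0) ->
        e = e' &
      forall e e', X e -> X e' -> e <> e' ->
        exists Y : set pterm,
          [/\ Y `<=` X, configs C1 (proj_1 L Y), configs C2 (proj_2 L Y) &
              (Y e /\ ~ Y e') \/ (~ Y e /\ Y e')]].

Definition cs_par (L : set A) (C1 C2 : cstruct) : cstruct :=
  CStruct (par_events L (events C1) (events C2)) [set X | par_config L C1 C2 X].

(* Only meaningful on initial processes; the [Past] case is a dummy value. *)
Fixpoint scs (P : proc) : cstruct :=
  match P with
  | Null => cs_nil
  | Pre a P' => cs_pre a (scs P')
  | Past _ _ _ => cs_nil
  | Sum P1 P2 => cs_sum (scs P1) (scs P2)
  | Par L P1 P2 => cs_par L (scs P1) (scs P2)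
  end.

(* The label set does not depend on the chosen sequence of transitions when P
   is reachable; collecting the labels of all of them avoids a choice. *)
Definition conf (P : proc) : set pterm :=
  [set t | exists s : seq pterm, steps (toinitial P) s P /\ List.In t s].

Definition denot (P : proc) : cstruct * set pterm :=
  (scs (toinitial P), conf P).

(* X --act(e)--> X' in C, where e is the event that is added. *)
Definition ctrans (C : cstruct) (X : set pterm) (e : pterm) (X' : set pterm) :
    Prop :=
  [/\ configs C X, configs C X', X `<=` X' & X' `\` X = [set e]].

(* apt as a relation, since its defining condition need not determine t (for
   instance when the same subprocess occurs several times in P).  The dagger
   carries any superscript xi, as actions executed in a synchronization have
   xi different from epsilon. *)
Definition apt (a : A) (xi : mark) (P' P : proc) (t : pterm) : Prop :=
  subproc (Past a xi P') P /\
  exists P2 P3 : proc,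
    [/\ subproc (Pre a (toinitial P')) P2, trans P2 t P3, act t = Some a &
        subproc (Past a xi (toinitial P')) P3].

End Terms.

Arguments Null {A}.
Arguments MEps {A}.

Section Logic.
Variables A Id : countType.

(* [FDia x a phi] is <x:a>phi, [FDecl x a phi] is (x:a)phi and [FRev x phi] is
   <<x>>phi. *)
Inductive form : Type :=
  | FTrue
  | FNot of form
  | FAnd of form & form
  | FDia of Id & A & form
  | FDecl of Id & A & form
  | FRev of Id & form.

Fixpoint fid (phi : form) : set Id :=
  match phi with
  | FTrue => set0
  | FNot phi' => fid phi'
  | FAnd phi1 phi2 => fid phi1 `|` fid phi2
  | FDia x _ phi' | FDecl x _ phi' => fid phi' `\ x
  | FRev x phi' => fid phi' `|` [set x]
  end.

Definition env : Type := Id -> option (pterm A).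

Definition dom (rho : env) : set Id := [set x | exists e, rho x = Some e].

Definition upd (rho : env) (x : Id) (e : pterm A) : env :=
  fun y => if y == x then Some e else rho y.

Definition permissible (rho : env) (X : set (pterm A)) (phi : form) : Prop :=
  fid phi `<=` dom rho /\
  forall x e, fid phi x -> rho x = Some e -> X e.

(* Satisfaction only makes sense for permissible environments, so
   permissibility is part of the judgement: in the modal clauses, the
   environment has to be permissible for the new configuration and the
   subformula. *)
Fixpoint csat (C : cstruct A) (X : set (pterm A)) (rho : env) (phi : form)
    {struct phi} : Prop :=
  permissible rho X phi /\
  match phi with
  | FTrue => True
  | FNot phi' => ~ csat C X rho phi'
  | FAnd phi1 phi2 => csat C X rho phi1 /\ csat C X rho phi2
  | FDia x a phi' =>
      exists e X', [/\ ctrans C X e X', act e = Some a &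
                       csat C X' (upd rho x e) phi']
  | FDecl x a phi' =>
      exists e, [/\ X e, act e = Some a & csat C X (upd rho x e) phi']
  | FRev x phi' =>
      exists e X', [/\ ctrans C X' e X, rho x = Some e & csat C X' rho phi']
  end.

(* Likewise, [psat P rho phi] requires P to be reachable, as [conf P] and hence
   permissibility are meaningful only then. *)
Fixpoint psat (P : proc A) (rho : env) (phi : form) {struct phi} : Prop :=
  [/\ reachable P, permissible rho (conf P) phi &
  match phi with
  | FTrue => True
  | FNot phi' => ~ psat P rho phi'
  | FAnd phi1 phi2 => psat P rho phi1 /\ psat P rho phi2
  | FDia x a phi' =>
      exists t P', [/\ trans P t P', act t = Some a &
                       psat P' (upd rho x t) phi']
  | FDecl x a phi' =>
      exists xi P' t, [/\ subproc (Past a xi P') P, apt a xi P' P t &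
                          psat P (upd rho x t) phi']
  | FRev x phi' =>
      exists t P', [/\ trans P' t P, rho x = Some t & psat P' rho phi']
  end].

End Logic.

(* Main.v *)
(* Ignoring superscripts, a process P is a position in the configuration structure
   of its initial version: its transitions are exactly the one-event extensions of
   the current configuration.  This is shown by structural induction, carrying
   along which event left which superscript.  Two facts let one pass back and forth
   between P and its configuration.  First, the superscripts determine the pairing
   of synchronized events, so all runs from toinitial(P) to P have the same labels;
   conversely, the configuration determines the superscripts, so two reachable
   processes with the same initial version and the same configuration are equal.
   Second, configurations are closed under bounded unions and intersections, whence
   every nonempty configuration has an event whose removal leaves a configuration,
   and so every configuration is reached by some process.  The reverse modality then
   needs no separate analysis: undoing e is reaching X \ {e} and redoing e.

   The relation apt does not tie the event to P, but permissibility does as soon as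
   the identifier occurs free; otherwise the identifier is irrelevant. *)

From Stdlib Require List.
Require Import Defs.
From mathcomp Require Import all_boot.
From mathcomp Require Import boolp classical_sets functions cardinality.

Set Implicit Arguments.
Unset Strict Implicit.
Unset Printing Implicit Defensive.

Local Open Scope classical_set_scope.

(** * Transitions and the events of a process *)

Section Processes.
Variable A : countType.
Implicit Types (P Q R : proc A) (t u e : pterm A) (m xi : mark A) (a b : A).
Implicit Types (L : set A) (X Y Z : set (pterm A)) (s : seq (pterm A)).

Lemma toinitial_id P : initial P -> toinitial P = P.
Proof.
elim: P => //= [a P IH /IH->|P1 IH1 P2 IH2 [/IH1-> /IH2->]
  |L P1 IH1 P2 IH2 [/IH1-> /IH2->]] //.
Qed.

Lemma initial_toinitial P : initial (toinitial P).
Proof. by elim: P => //=. Qed.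

Fixpoint mk t : mark A :=
  match t with
  | TAct _ => MEps
  | TPre _ t' | TPlusL t' | TPlusR t' | TParL _ t' | TParR _ t' => mk t'
  | TSync L t1 t2 => MSync L t1 t2
  end.

(* Proved transitions in which all the actions executed by [t] receive the same
   prescribed superscript; this is compositional, while [enr] rewrites the
   superscripts inside the components of a synchronization. *)
Inductive fire : proc A -> pterm A -> mark A -> proc A -> Prop :=
  | fire_actf a P xi : initial P -> fire (Pre a P) (TAct a) xi (Past a xi P)
  | fire_actp a m P t xi P' :
      fire P t xi P' -> fire (Past a m P) (TPre a t) xi (Past a m P')
  | fire_chol P1 P2 t xi P1' :
      fire P1 t xi P1' -> initial P2 ->
      fire (Sum P1 P2) (TPlusL t) xi (Sum P1' P2)
  | fire_chor P1 P2 t xi P2' :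
      fire P2 t xi P2' -> initial P1 ->
      fire (Sum P1 P2) (TPlusR t) xi (Sum P1 P2')
  | fire_parl L P1 P2 t a xi P1' :
      fire P1 t xi P1' -> act t = Some a -> ~ L a ->
      fire (Par L P1 P2) (TParL L t) xi (Par L P1' P2)
  | fire_parr L P1 P2 t a xi P2' :
      fire P2 t xi P2' -> act t = Some a -> ~ L a ->
      fire (Par L P1 P2) (TParR L t) xi (Par L P1 P2')
  | fire_syn L P1 P2 t1 t2 a xi P1' P2' :
      fire P1 t1 xi P1' -> fire P2 t2 xi P2' ->
      act t1 = Some a -> act t2 = Some a -> L a ->
      fire (Par L P1 P2) (TSync L t1 t2) xi (Par L P1' P2').

Lemma fire_enr P t m P' : fire P t m P' ->
  forall xi Q, enr_rec P' t xi Q -> fire P t xi Q.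
Proof.
elim=> {P t m P'}.
- by move=> a P m iP xi Q H; inversion H; subst; constructor.
- by move=> a m P t x P' _ IH xi Q H; inversion H; subst; constructor; apply: IH.
- by move=> P1 P2 t x P' _ IH iP xi Q H; inversion H; subst;
    constructor=> //; apply: IH.
- by move=> P1 P2 t x P' _ IH iP xi Q H; inversion H; subst;
    constructor=> //; apply: IH.
- move=> L P1 P2 t a x P' _ IH ta La xi Q H; inversion H; subst.
  by apply: fire_parl ta La; apply: IH.
- move=> L P1 P2 t a x P' _ IH ta La xi Q H; inversion H; subst.
  by apply: fire_parr ta La; apply: IH.
- move=> L P1 P2 t1 t2 a x P1' P2' _ IH1 _ IH2 t1a t2a La xi Q H.
  inversion H; subst.
  by apply: fire_syn t1a t2a La; [apply: IH1|apply: IH2].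
Qed.

Lemma trans_fire P t P' : trans P t P' -> fire P t (mk t) P'.
Proof.
elim=> {P t P'} /=; try by move=> *; constructor.
- by move=> L P1 P2 t a P1' _ IH ta La; apply: fire_parl ta La.
- by move=> L P1 P2 t a P1' _ IH ta La; apply: fire_parr ta La.
- move=> L P1 P2 t1 t2 a P1' P2' Q _ IH1 _ IH2 t1a t2a La H.
  rewrite /enr in H; inversion H; subst.
  by apply: fire_syn t1a t2a La; [exact: fire_enr IH1 _ _ _|exact: fire_enr IH2 _ _ _].
Qed.

Lemma fire_enr_ex P t m P' : fire P t m P' -> forall xi, exists Q, enr_rec P' t xi Q.
Proof.
elim=> {P t m P'}.
- by move=> a P m _ xi; eexists; constructor.
- by move=> a m P t x P' _ IH xi; have [Q ?] := IH xi;
    eexists; constructor; eassumption.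
- by move=> P1 P2 t x P' _ IH _ xi; have [Q ?] := IH xi;
    eexists; constructor; eassumption.
- by move=> P1 P2 t x P' _ IH _ xi; have [Q ?] := IH xi;
    eexists; constructor; eassumption.
- by move=> L P1 P2 t a x P' _ IH _ _ xi; have [Q ?] := IH xi;
    eexists; constructor; eassumption.
- by move=> L P1 P2 t a x P' _ IH _ _ xi; have [Q ?] := IH xi;
    eexists; constructor; eassumption.
- move=> L P1 P2 t1 t2 a x P1' P2' _ IH1 _ IH2 _ _ _ xi.
  have [Q1 ?] := IH1 xi; have [Q2 ?] := IH2 xi.
  by eexists; constructor; eassumption.
Qed.

Lemma fire_toinitial P t xi P' : fire P t xi P' -> toinitial P' = toinitial P.
Proof. by elim=> //= *; congruence. Qed.

Lemma fire_subproc P t xi P' : fire P t xi P' ->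
  forall b m R, subproc (Past b m R) P ->
  exists2 R', subproc (Past b m R') P' & toinitial R' = toinitial R.
Proof.
elim=> {P t xi P'} /=.
- by move=> a P xi _ b m R [//|H]; exists R => //; right.
- move=> a m P t xi P' /fire_toinitial tP IH b n R [[-> -> ->]|/IH[R' H E]].
  + by exists P' => //; left.
  + by exists R' => //; right.
- move=> P1 P2 t xi P1' _ IH _ b m R [//|[/IH[R' H E]|H]].
  + by exists R' => //; right; left.
  + by exists R => //; right; right.
- move=> P1 P2 t xi P1' _ IH _ b m R [//|[H|/IH[R' H E]]].
  + by exists R => //; right; left.
  + by exists R' => //; right; right.
- move=> L P1 P2 t a xi P1' _ IH _ _ b m R [//|[/IH[R' H E]|H]].
  + by exists R' => //; right; left.
  + by exists R => //; right; right.
- move=> L P1 P2 t a xi P1' _ IH _ _ b m R [//|[H|/IH[R' H E]]].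
  + by exists R => //; right; left.
  + by exists R' => //; right; right.
- move=> L P1 P2 t1 t2 a xi P1' P2' _ IH1 _ IH2 _ _ _ b m R
    [//|[/IH1[R' H E]|/IH2[R' H E]]].
  + by exists R' => //; right; left.
  + by exists R' => //; right; right.
Qed.

Lemma subproc_initial P a m R : initial P -> ~ subproc (Past a m R) P.
Proof.
elim: P => /= [_ []//|b P IH iP []//||P1 IH1 P2 IH2 [i1 i2] []//
  |L P1 IH1 P2 IH2 [i1 i2] []//]; first exact: IH.
- by [].
- by case; [exact: IH1|exact: IH2].
- by case; [exact: IH1|exact: IH2].
Qed.

Lemma subproc_fire P t xi P' : fire P t xi P' ->
  forall b m R, subproc (Past b m R) P' ->
  (exists R', subproc (Past b m R') P) \/ act t = Some b /\ m = xi.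
Proof.
elim=> {P t xi P'} /=.
- move=> a P xi iP b m R [[<- <- _]|H]; first by right.
  by case: (subproc_initial iP H).
- move=> a m P t xi P' _ IH b n R [[-> -> _]|/IH[[R' H]|H]].
  + by left; exists P; left.
  + by left; exists R'; right.
  + by right.
- move=> P1 P2 t xi P1' _ IH _ b m R [//|[/IH[[R' H]|H]|H]].
  + by left; exists R'; right; left.
  + by right.
  + by left; exists R; right; right.
- move=> P1 P2 t xi P1' _ IH _ b m R [//|[H|/IH[[R' H]|H]]].
  + by left; exists R; right; left.
  + by left; exists R'; right; right.
  + by right.
- move=> L P1 P2 t a xi P1' _ IH _ _ b m R [//|[/IH[[R' H]|H]|H]].
  + by left; exists R'; right; left.
  + by right.
  + by left; exists R; right; right.
- move=> L P1 P2 t a xi P1' _ IH _ _ b m R [//|[H|/IH[[R' H]|H]]].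
  + by left; exists R; right; left.
  + by left; exists R'; right; right.
  + by right.
- move=> L P1 P2 t1 t2 a xi P1' P2' _ IH1 _ IH2 t1a t2a La b m R.
  rewrite t1a t2a eqxx; move=> [//|[/IH1[[R' H]|H]|/IH2[[R' H]|H]]].
  + by left; exists R'; right; left.
  + by right; rewrite -t1a.
  + by left; exists R'; right; right.
  + by right; rewrite -t2a.
Qed.

Lemma fire_act P t xi P' : fire P t xi P' -> forall b, act t = Some b ->
  exists R, [/\ initial R, subproc (Pre b R) P & subproc (Past b xi R) P'].
Proof.
elim=> {P t xi P'} /=.
- by move=> a P xi iP b [<-]; exists P; split=> //; left.
- by move=> a m P t xi P' _ IH b /IH[R [? ? ?]]; exists R; split=> //; right.
- move=> P1 P2 t xi P1' _ IH _ b /IH[R [? ? ?]]; exists R; split=> //;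
    right; left=> //.
- move=> P1 P2 t xi P1' _ IH _ b /IH[R [? ? ?]]; exists R; split=> //;
    right; right=> //.
- move=> L P1 P2 t a xi P1' _ IH _ _ b /IH[R [? ? ?]]; exists R; split=> //;
    right; left=> //.
- move=> L P1 P2 t a xi P1' _ IH _ _ b /IH[R [? ? ?]]; exists R; split=> //;
    right; right=> //.
- move=> L P1 P2 t1 t2 a xi P1' P2' _ IH1 _ IH2 t1a t2a La b; rewrite t1a t2a eqxx => -[<-].
  by have [R [? ? ?]] := IH1 _ t1a; exists R; split=> //; right; left.
Qed.

(* The events recorded by the superscripts of a process.  An executed action
   lying outside every enclosing synchronization set is a plain event; otherwise
   its superscript names the synchronization at the outermost enclosing
   parallel composition that forces one. *)
Fixpoint evt P t : Prop :=
  match P, t with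
  | Past a _ _, TAct b => a = b
  | Past a _ P', TPre b t' => a = b /\ evt P' t'
  | Sum P1 _, TPlusL t' => evt P1 t'
  | Sum _ P2, TPlusR t' => evt P2 t'
  | Par L P1 _, TParL K t' =>
      K = L /\ (exists a, act t' = Some a /\ ~ L a) /\ evt P1 t'
  | Par L _ P2, TParR K t' =>
      K = L /\ (exists a, act t' = Some a /\ ~ L a) /\ evt P2 t'
  | Par L P1 _, TSync K t1 t2 => K = L /\
      exists a, [/\ act t1 = Some a, act t2 = Some a, L a &
        exists R, subproc (Past a (MSync L t1 t2) R) P1]
  | _, _ => False
  end.

Lemma evt_initial P t : initial P -> ~ evt P t.
Proof.
elim: P t => [|b P _|b m P _|P1 IH1 P2 IH2|L P1 IH1 P2 IH2] [] //=;
  try by move=> *; intuition eauto.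
move=> K t1 t2 [i1 _] [_ [a [_ _ _ [R]]]]; exact: subproc_initial.
Qed.

Lemma evt_fire P t xi P' : fire P t xi P' ->
  forall u, (act u = act t -> xi = mk t) -> (evt P' u <-> evt P u \/ u = t).
Proof.
elim=> {P t xi P'} /=.
- move=> a P xi iP [b|b u|u|u|K u|K u|K u1 u2] _ /=; split; try by move=> [].
  + by move=> ->; right.
  + by case=> // -[].
  + by move=> [_ /evt_initial].
- move=> a m P t xi P' _ IH [b|b u|u|u|K u|K u|K u1 u2] E /=; split;
    try by move=> [].
  + by move=> ->; left.
  + by move=> [-> /(IH u E)[|->]]; auto.
  + by have I := IH u E; move=> [[-> H]|[Eb Eu]]; split=> //; apply/I; auto.
- move=> P1 P2 t xi P' _ IH iP [b|b u|u|u|K u|K u|K u1 u2] E /=; split;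
    try first [by auto | by case | by move=> []//; auto].
  + by move/(IH u E)=> [|->]; auto.
  + by move=> [H|[Eu]]; apply/(IH u E); auto.
- move=> P1 P2 t xi P' _ IH iP [b|b u|u|u|K u|K u|K u1 u2] E /=; split;
    try first [by auto | by case | by move=> []//; auto].
  + by move/(IH u E)=> [|->]; auto.
  + by move=> [H|[Eu]]; apply/(IH u E); auto.
- move=> L P1 P2 t a xi P' F IH ta La [b|b u|u|u|K u|K u|K u1 u2] E /=; split;
    try first [by auto | by case | by move=> []//; auto].
  + by move=> [-> [H /(IH u E)[|->]]]; auto.
  + move=> [[-> [H1 H2]]|[-> H]]; split=> //; split=> //; try by apply/(IH u E); auto.
    by exists a; rewrite H.
  + move=> [-> [b [u1b u2b Lb [R /(subproc_fire F)[H|[tb _]]]]]].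
      by left; split=> //; exists b.
    by move: tb Lb; rewrite ta => -[<-].
  + move=> [[-> [b [u1b u2b Lb [R /(fire_subproc F)[R' H _]]]]]|//].
    by split=> //; exists b; split=> //; exists R'.
- move=> L P1 P2 t a xi P' F IH ta La [b|b u|u|u|K u|K u|K u1 u2] E /=; split;
    try first [by auto | by case | by move=> []//; auto].
  + by move=> [-> [H /(IH u E)[|->]]]; auto.
  + move=> [[-> [H1 H2]]|[-> H]]; split=> //; split=> //; try by apply/(IH u E); auto.
    by exists a; rewrite H.
- move=> L P1 P2 t1 t2 a xi P1' P2' F1 IH1 F2 IH2 t1a t2a La u.
  rewrite t1a t2a eqxx.
  case: u => [b|b u|u|u|K u|K u|K u1 u2] E /=; split;
    try first [by auto | by case | by move=> []//; auto].
  + move=> [-> [[b [ub Lb]] /IH1 H]]; left; split=> //; split; first by exists b.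
    case: H => // [|H]; first by rewrite ub t1a => -[H]; case: Lb; rewrite H.
    by case: Lb; move: La; move: t1a ub; rewrite H => -> [->].
  + move=> [[-> [[b [ub Lb]] H]]|//]; split=> //; split; first by exists b.
    by apply/IH1; [rewrite ub t1a => -[H']; case: Lb; rewrite H'|left].
  + move=> [-> [[b [ub Lb]] /IH2 H]]; left; split=> //; split; first by exists b.
    case: H => // [|H]; first by rewrite ub t2a => -[H]; case: Lb; rewrite H.
    by case: Lb; move: La; move: t2a ub; rewrite H => -> [->].
  + move=> [[-> [[b [ub Lb]] H]]|//]; split=> //; split; first by exists b.
    by apply/IH2; [rewrite ub t2a => -[H']; case: Lb; rewrite H'|left].
  + move=> [-> [b [u1b u2b Lb [R /(subproc_fire F1)[H|[tb H]]]]]].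
      by left; split=> //; exists b.
    right; move: E; rewrite /= u1b u2b eqxx -tb t1a -H => /(_ erefl).
    by case=> -> ->.
  + move=> [[-> [b [u1b u2b Lb [R /(fire_subproc F1)[R' H _]]]]]|].
      by split=> //; exists b; split=> //; exists R'.
    move=> [H1 H2 H3]; split=> //; exists a; subst; split=> //.
    have [R [_ _ H]] := fire_act F1 t1a; exists R.
    by rewrite E //= in H; rewrite t1a t2a eqxx.
Qed.

Lemma evt_trans P t P' : trans P t P' -> evt P' = evt P `|` [set t].
Proof.
move=> /trans_fire F; rewrite predeqE => u; exact: evt_fire F _ _.
Qed.

Lemma steps_rcons P s Q t R : steps P s Q -> trans Q t R -> steps P (rcons s t) R.
Proof.
elim=> [{}P|{}P u P' {}s {}Q tr _ IH /IH] H; last exact: steps_cons tr H.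
exact: steps_cons H (steps_nil _).
Qed.

Lemma steps_toinitial P s Q : steps P s Q -> toinitial Q = toinitial P.
Proof. by elim=> // {}P u P' {}s {}Q /trans_fire/fire_toinitial <-. Qed.

Lemma steps_evt P s Q : steps P s Q -> evt Q = evt P `|` [set t | List.In t s].
Proof.
elim=> [{}P|{}P u P' {}s {}Q tr _ ->].
  by rewrite predeqE => t; split=> [|[|//]]; auto; left.
rewrite (evt_trans tr) predeqE => t; split=> /=.
  by move=> [[|->]|]; [left|right; left|right; right].
by move=> [|[|]]; [left; left|left; right|right].
Qed.

Lemma reachable_steps P : reachable P -> exists s, steps (toinitial P) s P.
Proof.
move=> [P0 [s [iP st]]]; exists s.
by rewrite (steps_toinitial st) (toinitial_id iP).
Qed.

Lemma steps_labels P s Q : initial P -> steps P s Q -> [set t | List.In t s] = evt Q.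
Proof.
move=> iP /steps_evt ->; rewrite predeqE => t; split; first by right.
by case=> // /evt_initial.
Qed.

Lemma conf_evt P : reachable P -> conf P = evt P.
Proof.
move=> /reachable_steps[s st].
rewrite predeqE => t; split=> [[s' [st' H]]|H].
  by rewrite -(steps_labels (initial_toinitial P) st').
exists s; split=> //.
by move: H; rewrite -(steps_labels (initial_toinitial P) st).
Qed.

Lemma reachable_trans P t P' : reachable P -> trans P t P' -> reachable P'.
Proof.
move=> [P0 [s [iP st]]] tr; exists P0, (rcons s t); split=> //; exact: steps_rcons st tr.
Qed.

End Processes.

(** * Stability and connectedness of the denotations *)

Section Configurations.
Variable A : countType.
Implicit Types (P : proc A) (t u e : pterm A) (a : A) (L : set A).
Implicit Types (C : cstruct A) (X Y Z : set (pterm A)).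

Lemma proj_1U L X Y : proj_1 L (X `|` Y) = proj_1 L X `|` proj_1 L Y.
Proof.
rewrite predeqE => t; split=> [[[H|H]|[u [H|H]]]|[[H|[u H]]|[H|[u H]]]].
- by left; left.
- by right; left.
- by left; right; exists u.
- by right; right; exists u.
- by left; left.
- by right; exists u; left.
- by left; right.
- by right; exists u; right.
Qed.

Lemma proj_2U L X Y : proj_2 L (X `|` Y) = proj_2 L X `|` proj_2 L Y.
Proof.
rewrite predeqE => t; split=> [[[H|H]|[u [H|H]]]|[[H|[u H]]|[H|[u H]]]].
- by left; left.
- by right; left.
- by left; right; exists u.
- by right; right; exists u.
- by left; left.
- by right; exists u; left.
- by left; right.
- by right; exists u; right.
Qed.

Lemma proj_10 L : proj_1 L (set0 : set (pterm A)) = set0.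
Proof. by rewrite predeqE => t; split=> // -[|[]]. Qed.

Lemma proj_20 L : proj_2 L (set0 : set (pterm A)) = set0.
Proof. by rewrite predeqE => t; split=> // -[|[]]. Qed.

Lemma proj_1P L X t : proj_1 L X t <-> exists2 e, X e & proj_1 L [set e] t.
Proof.
split=> [[H|[u H]]|[e Xe [H|[u H]]]].
- by exists (TParL L t) => //; left.
- by exists (TSync L t u) => //; right; exists u.
- by left; rewrite /= in H; rewrite H.
- by right; exists u; rewrite /= in H; rewrite H.
Qed.

Lemma proj_2P L X t : proj_2 L X t <-> exists2 e, X e & proj_2 L [set e] t.
Proof.
split=> [[H|[u H]]|[e Xe [H|[u H]]]].
- by exists (TParR L t) => //; left.
- by exists (TSync L u t) => //; right; exists u.
- by left; rewrite /= in H; rewrite H.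
- by right; exists u; rewrite /= in H; rewrite H.
Qed.

Lemma proj_1_eq L e t : proj_1 L [set e] t -> proj_1 L [set e] = [set t].
Proof.
move=> H; rewrite predeqE => u; split=> [|->//].
by case: H => [<-|[? <-]] [[]|[? []]].
Qed.

Lemma proj_2_eq L e t : proj_2 L [set e] t -> proj_2 L [set e] = [set t].
Proof.
move=> H; rewrite predeqE => u; split=> [|->//].
by case: H => [<-|[? <-]] [[]|[? []]].
Qed.

Lemma proj_1_parl L t : proj_1 L [set TParL L t] = [set t].
Proof. by apply: proj_1_eq; left. Qed.

Lemma proj_2_parl L t : proj_2 L [set TParL L t] = set0.
Proof. by rewrite predeqE => u; split=> // -[|[]]. Qed.

Lemma proj_1_parr L t : proj_1 L [set TParR L t] = set0.
Proof. by rewrite predeqE => u; split=> // -[|[]]. Qed.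

Lemma proj_2_parr L t : proj_2 L [set TParR L t] = [set t].
Proof. by apply: proj_2_eq; left. Qed.

Lemma proj_1_sync L t u : proj_1 L [set TSync L t u] = [set t].
Proof. by apply: proj_1_eq; right; exists u. Qed.

Lemma proj_2_sync L t u : proj_2 L [set TSync L t u] = [set u].
Proof. by apply: proj_2_eq; right; exists t. Qed.

Lemma par_events_parl L C1 C2 t a : events C1 t -> act t = Some a -> ~ L a ->
  par_events L (events C1) (events C2) (TParL L t).
Proof. by move=> Et ta La; left; left; exists t => //; split=> //; exists a. Qed.

Lemma par_events_parr L C1 C2 t a : events C2 t -> act t = Some a -> ~ L a ->
  par_events L (events C1) (events C2) (TParR L t).
Proof. by move=> Et ta La; left; right; exists t => //; split=> //; exists a. Qed.

Lemma par_events_sync L C1 C2 t u a : events C1 t -> events C2 u ->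
  act t = Some a -> act u = Some a -> L a ->
  par_events L (events C1) (events C2) (TSync L t u).
Proof. by move=> Et Eu ta ua La; right; exists t, u; split=> //; exists a. Qed.

Lemma par_config_proj L C1 C2 X e e' t : par_config L C1 C2 X -> X e -> X e' ->
  proj_1 L [set e] t /\ proj_1 L [set e'] t \/
  proj_2 L [set e] t /\ proj_2 L [set e'] t -> e = e'.
Proof.
move=> [_ _ H _] Xe Xe' [[p p']|[p p']]; apply: H => //; [left|right].
- by rewrite (proj_1_eq p) (proj_1_eq p'); split=> //; exists t.
- by rewrite (proj_2_eq p) (proj_2_eq p'); split=> //; exists t.
Qed.

Lemma par_config_add L C1 C2 X e : par_config L C1 C2 X ->
  par_events L (events C1) (events C2) e ->
  configs C1 (proj_1 L X `|` proj_1 L [set e]) ->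
  configs C2 (proj_2 L X `|` proj_2 L [set e]) ->
  (forall t, proj_1 L [set e] t -> ~ proj_1 L X t) ->
  (forall t, proj_2 L [set e] t -> ~ proj_2 L X t) ->
  ~ X e /\ par_config L C1 C2 (X `|` [set e]).
Proof.
move=> cX Ee; rewrite -proj_1U -proj_2U => c1 c2 n1 n2.
have nXe : ~ X e.
  move=> Xe; case: Ee => [[|]|].
  - move=> [t _ te]; apply: (n1 t); first by rewrite -te proj_1_parl.
    by left; rewrite te.
  - move=> [t _ te]; apply: (n2 t); first by rewrite -te proj_2_parr.
    by left; rewrite te.
  - move=> [t [u [te _ _ _]]]; apply: (n1 t); first by rewrite te proj_1_sync.
    by right; exists u; rewrite -te.
split=> //; have [[sX fX] [c1X c2X] H3 H4] := cX.
split=> //.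
- split; first by move=> f [/sX//|->].
  by rewrite finite_setU; split=> //; exact: finite_set1.
- have new f : X f ->
    (proj_1 L [set e] = proj_1 L [set f] /\ proj_1 L [set e] !=set0) \/
    (proj_2 L [set e] = proj_2 L [set f] /\ proj_2 L [set e] !=set0) -> False.
    move=> Xf [[E [t et]]|[E [t et]]].
    + by apply: (n1 t et); apply/proj_1P; exists f => //; rewrite -E.
    + by apply: (n2 t et); apply/proj_2P; exists f => //; rewrite -E.
  move=> f g [Xf|->] [Xg|->] //; first exact: H3.
  + move=> H; case: (new f Xf); case: H => -[E ?]; [left|right];
      by rewrite -E.
  + by move=> /(new g Xg).
- have XU : X `<=` X `|` [set e] by move=> z; left.
  move=> f g [Xf|->] [Xg|->] //.
  + move=> /(H4 _ _ Xf Xg)[Y [YX ? ? ?]]; exists Y; split=> //.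
    by move=> z /YX; left.
  + by move=> _; exists X; split=> //; left.
  + by move=> _; exists X; split=> //; right.
Qed.

Lemma par_config_new L C1 C2 X e : par_config L C1 C2 (X `|` [set e]) -> ~ X e ->
  (forall t, proj_1 L [set e] t -> ~ proj_1 L X t) /\
  (forall t, proj_2 L [set e] t -> ~ proj_2 L X t).
Proof.
move=> cX nXe; split=> t et.
- move=> /proj_1P[f Xf ft]; apply: nXe.
  suff -> : e = f by [].
  by apply: (par_config_proj (t := t) cX); [right|left|left].
- move=> /proj_2P[f Xf ft]; apply: nXe.
  suff -> : e = f by [].
  by apply: (par_config_proj (t := t) cX); [right|left|right].
Qed.

Lemma configs_preP C a X : configs (cs_pre a C) X <-> X = set0 \/
  [/\ X (TAct a), configs C (TPre a @^-1` X) &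
      forall t, X t -> t = TAct a \/ exists u, t = TPre a u].
Proof.
split=> [[->|[Y cY <-]]|[->|[Xa cX sX]]]; first by left.
- right; split=> [|| t]; first by left.
    suff -> : TPre a @^-1` ([set TAct a] `|` TPre a @` Y) = Y by [].
    by rewrite predeqE => t; split=> [[//|[u Yu [<-]]]|Yt]; [|right; exists t].
  by move=> [->|[u _ <-]]; [left|right; exists u].
- by left.
- right; exists (TPre a @^-1` X) => //; rewrite predeqE => t; split.
    by move=> [->|[u Xu <-]].
  by move=> Xt; case: (sX t Xt) => [->|[u tu]]; [left|right; exists u => //; rewrite /= -tu].
Qed.

Lemma configs_sumP C1 C2 X : configs (cs_sum C1 C2) X <->
  (configs C1 (@TPlusL A @^-1` X) /\ forall t, X t -> exists u, t = TPlusL u) \/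
  (configs C2 (@TPlusR A @^-1` X) /\ forall t, X t -> exists u, t = TPlusR u).
Proof.
have preK (f : pterm A -> pterm A) Y : injective f -> f @^-1` (f @` Y) = Y.
  move=> fI; rewrite predeqE => t; split=> [[u Yu /fI<-]//|Yt]; by exists t.
have imK (f : pterm A -> pterm A) : (forall t, X t -> exists u, t = f u) ->
    f @` (f @^-1` X) = X.
  move=> H; rewrite predeqE => t; split=> [[u Xu <-]//|Xt].
  by have [u tu] := H _ Xt; exists u => //; rewrite /= -tu.
split=> [[[Y cY <-]|[Y cY <-]]|[[cX sX]|[cX sX]]].
- by left; rewrite preK => [|? ? []//]; split=> // t [u _ <-]; exists u.
- by right; rewrite preK => [|? ? []//]; split=> // t [u _ <-]; exists u.
- by left; exists (@TPlusL A @^-1` X) => //; apply: imK.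
- by right; exists (@TPlusR A @^-1` X) => //; apply: imK.
Qed.

Lemma par_config0 L C1 C2 : configs C1 set0 -> configs C2 set0 ->
  par_config L C1 C2 set0.
Proof.
by move=> c1 c2; split=> //; [split=> //; exact: finite_set0|rewrite proj_10 proj_20].
Qed.

Lemma scs0 P : configs (scs P) set0.
Proof.
elim: P => //= [a P IH|P1 IH1 P2 IH2|L P1 IH1 P2 IH2].
- by left.
- by left; exists set0 => //; rewrite image_set0.
- exact: par_config0.
Qed.

Lemma scs_events P X : configs (scs P) X -> X `<=` events (scs P).
Proof.
elim: P X => /= [|a P IH|a m P _|P1 IH1 P2 IH2|L P1 IH1 P2 IH2] X.
- by move=> ->.
- move=> [->//|[Y cY <-]] t [|[u Yu <-]]; first by left.
  by right; exists u => //; apply: IH Yu.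
- by move=> ->.
- by move=> [[Y cY <-]|[Y cY <-]] t [u Yu <-]; [left|right]; exists u => //;
    [apply: IH1 Yu|apply: IH2 Yu].
- by move=> [[]].
Qed.

Lemma scs_finite P X : configs (scs P) X -> finite_set X.
Proof.
elim: P X => /= [|a P IH|a m P _|P1 IH1 P2 IH2|L P1 IH1 P2 IH2] X.
- by move=> ->; exact: finite_set0.
- move=> [->|[Y /IH fY <-]]; first exact: finite_set0.
  by rewrite finite_setU; split; [exact: finite_set1|exact: finite_image].
- by move=> ->; exact: finite_set0.
- by move=> [[Y /IH1 fY <-]|[Y /IH2 fY <-]]; exact: finite_image.
- by move=> [[]].
Qed.

Definition stable C := forall X Y Z, configs C X -> configs C Y -> configs C Z ->
  X `<=` Z -> Y `<=` Z -> configs C (X `|` Y) /\ configs C (X `&` Y).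

Lemma stable_pre a C : stable C -> stable (cs_pre a C).
Proof.
move=> st X Y Z cX cY cZ XZ YZ.
case/configs_preP: (cX) => [X0|[Xa cX' sX]];
  first by rewrite X0 set0U set0I; split=> //; left.
case/configs_preP: (cY) => [Y0|[Ya cY' sY]];
  first by rewrite Y0 setU0 setI0; split=> //; left.
case/configs_preP: (cZ) => [Z0|[_ cZ' _]]; first by move: XZ; rewrite Z0 => /(_ _ Xa).
have [cU cI] := st _ _ _ cX' cY' cZ' (fun t => XZ _) (fun t => YZ _).
split; apply/configs_preP; right; split=> //.
- by left.
- by move=> t [/sX|/sY].
- by move=> t [/sX].
Qed.

Lemma stable_sum C1 C2 : configs C1 set0 -> configs C2 set0 ->
  stable C1 -> stable C2 -> stable (cs_sum C1 C2).
Proof.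
move=> c1 c2 st1 st2 X Y Z cX cY cZ.
case/configs_sumP: cZ => -[cZ sZ] XZ YZ.
- have pre W : W `<=` Z -> configs (cs_sum C1 C2) W -> configs C1 (@TPlusL A @^-1` W).
    move=> WZ /configs_sumP[[]//|[_ sW]].
    suff -> : @TPlusL A @^-1` W = set0 by [].
    by rewrite predeqE => t; split=> // /sW[].
  have [cU cI] := st1 _ _ _ (pre X XZ cX) (pre Y YZ cY) cZ
    (fun t => XZ _) (fun t => YZ _).
  by split; apply/configs_sumP; left; split=> // t [];
    [move=> /XZ/sZ|move=> /YZ/sZ|move=> /XZ/sZ].
- have pre W : W `<=` Z -> configs (cs_sum C1 C2) W -> configs C2 (@TPlusR A @^-1` W).
    move=> WZ /configs_sumP[[_ sW]|[]//].
    suff -> : @TPlusR A @^-1` W = set0 by [].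
    by rewrite predeqE => t; split=> // /sW[].
  have [cU cI] := st2 _ _ _ (pre X XZ cX) (pre Y YZ cY) cZ
    (fun t => XZ _) (fun t => YZ _).
  by split; apply/configs_sumP; right; split=> // t [];
    [move=> /XZ/sZ|move=> /YZ/sZ|move=> /XZ/sZ].
Qed.

Lemma proj_1S L X Y : X `<=` Y -> proj_1 L X `<=` proj_1 L Y.
Proof. by move=> XY t [/XY|[u /XY H]]; [left|right; exists u]. Qed.

Lemma proj_2S L X Y : X `<=` Y -> proj_2 L X `<=` proj_2 L Y.
Proof. by move=> XY t [/XY|[u /XY H]]; [left|right; exists u]. Qed.

Lemma par_config_projI L C1 C2 X Y Z : par_config L C1 C2 Z ->
  X `<=` Z -> Y `<=` Z ->
  proj_1 L (X `&` Y) = proj_1 L X `&` proj_1 L Y /\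
  proj_2 L (X `&` Y) = proj_2 L X `&` proj_2 L Y.
Proof.
move=> cZ XZ YZ; split; rewrite predeqE => t; split.
- by move=> H; split; apply: proj_1S H => ? [].
- move=> [/proj_1P[e Xe et] /proj_1P[f Yf ft]]; apply/proj_1P; exists e => //.
  by split=> //; rewrite (par_config_proj (t := t) cZ (XZ _ Xe) (YZ _ Yf)) //; left.
- by move=> H; split; apply: proj_2S H => ? [].
- move=> [/proj_2P[e Xe et] /proj_2P[f Yf ft]]; apply/proj_2P; exists e => //.
  by split=> //; rewrite (par_config_proj (t := t) cZ (XZ _ Xe) (YZ _ Yf)) //; right.
Qed.

Lemma par_config_sub L C1 C2 X Y : stable C1 -> stable C2 ->
  par_config L C1 C2 X -> Y `<=` X ->
  configs C1 (proj_1 L Y) -> configs C2 (proj_2 L Y) -> par_config L C1 C2 Y.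
Proof.
move=> st1 st2 cX YX c1 c2; have [[sX fX] [c1X c2X] H3 H4] := cX.
split=> //.
- by split; [move=> e /YX/sX|exact: sub_finite_set fX].
- by move=> e f /YX Xe /YX; exact: H3.
- move=> e f Ye Yf /(H4 _ _ (YX _ Ye) (YX _ Yf))[Z [ZX c1Z c2Z ef]].
  have [E1 E2] := par_config_projI cX ZX YX.
  exists (Z `&` Y); split.
  + by move=> ? [].
  + rewrite E1; have [] // := st1 _ _ _ c1Z c1 c1X; exact: proj_1S.
  + rewrite E2; have [] // := st2 _ _ _ c2Z c2 c2X; exact: proj_2S.
  + by case: ef => -[He Hf]; [left|right]; split=> // -[].
Qed.

Lemma stable_par L C1 C2 : stable C1 -> stable C2 -> stable (cs_par L C1 C2).
Proof.
move=> st1 st2 X Y Z cX cY cZ XZ YZ.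
have [_ [c1X c2X] _ _] := cX; have [_ [c1Y c2Y] _ _] := cY.
have [_ [c1Z c2Z] _ _] := cZ.
have [U1 I1] := st1 _ _ _ c1X c1Y c1Z (proj_1S XZ) (proj_1S YZ).
have [U2 I2] := st2 _ _ _ c2X c2Y c2Z (proj_2S XZ) (proj_2S YZ).
have [E1 E2] := par_config_projI cZ XZ YZ.
split; apply: par_config_sub cZ _ _ _ => //.
- by move=> ? [/XZ|/YZ].
- by rewrite proj_1U.
- by rewrite proj_2U.
- by move=> ? [/XZ].
- by rewrite E1.
- by rewrite E2.
Qed.

Lemma scs_stable P : stable (scs P).
Proof.
elim: P => /= [|a P IH|a m P _|P1 IH1 P2 IH2|L P1 IH1 P2 IH2].
- by move=> X Y Z /= -> -> _ _ _; rewrite setU0 setI0.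
- exact: stable_pre.
- by move=> X Y Z /= -> -> _ _ _; rewrite setU0 setI0.
- by apply: stable_sum => //; exact: scs0.
- exact: stable_par.
Qed.

Lemma finite_list X : finite_set X ->
  exists l : seq (pterm A), forall t, X t -> List.In t l.
Proof.
move=> /(@finite_seqP {classic (pterm A)})[l ->]; exists l => t.
elim: l => //= u l IH; rewrite inE => /orP[/eqP->|/IH]; by [left|right].
Qed.

(* A maximal proper subset of [X] that projects onto configurations lacks just
   one event: if it lacked two, the union with a subset separating them would
   still be proper. *)
Lemma par_config_pred L C1 C2 X : stable C1 -> stable C2 ->
  configs C1 set0 -> configs C2 set0 ->
  par_config L C1 C2 X -> X !=set0 ->
  exists2 e, X e & par_config L C1 C2 (X `\ e).
Proof.
move=> st1 st2 c10 c20 cX [e0 Xe0].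
have [[sX fX] [c1X c2X] H3 H4] := cX.
suff max n : forall l : seq (pterm A), (size l <= n)%N ->
    forall Y, Y `<=` X -> configs C1 (proj_1 L Y) -> configs C2 (proj_2 L Y) ->
    (forall t, X t -> ~ Y t -> List.In t l) -> (exists2 e, X e & ~ Y e) ->
    exists2 e, X e & par_config L C1 C2 (X `\ e).
  have [l Hl] := finite_list fX.
  apply: (max (size l) l _ set0) => //.
  - by rewrite proj_10.
  - by rewrite proj_20.
  - by move=> t /Hl.
  - by exists e0.
elim: n => [|n IH] l ln Y YX c1 c2 cov [e Xe nYe].
  by have := cov _ Xe nYe; case: l ln {cov}.
have [uniq|] := pselect (forall f, X f -> ~ Y f -> f = e).
  exists e => //; suff -> : X `\ e = Y by exact: par_config_sub cX _ _ _.
  rewrite predeqE => f; split=> [[Xf fe]|Yf].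
    by apply: contrapT => /(uniq f Xf).
  by split; [exact: YX|move=> fe; case: nYe; rewrite -fe].
move=> /existsNP[f /not_implyP[Xf /not_implyP[nYf fe]]].
have [Z [ZX c1Z c2Z ef]] := H4 _ _ Xe Xf (fun E => fe (esym E)).
have U1 : configs C1 (proj_1 L (Y `|` Z)).
  by rewrite proj_1U; have [] // := st1 _ _ _ c1 c1Z c1X; exact: proj_1S.
have U2 : configs C2 (proj_2 L (Y `|` Z)).
  by rewrite proj_2U; have [] // := st2 _ _ _ c2 c2Z c2X; exact: proj_2S.
have [g [h [Xg nYg Zg Xh nYZh]]] : exists g h, [/\ X g, ~ Y g, Z g, X h & ~ (Y `|` Z) h].
  by case: ef => -[? ?]; [exists e, f|exists f, e]; split=> // -[].
have [l1 [l2 El]] := List.in_split _ _ (cov _ Xg nYg).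
apply: (IH (l1 ++ l2) _ (Y `|` Z)) => //.
- by move: ln; rewrite El !size_cat /= addnS.
- by move=> t [/YX|/ZX].
- move=> t Xt nt; have Hl := cov _ Xt (fun Yt => nt (or_introl Yt)).
  rewrite El in Hl; apply: List.in_or_app.
  case: (List.in_app_or _ _ _ Hl) => [|[gt|]]; [by left| |by right].
  by case: nt; right; rewrite -gt.
- by exists h.
Qed.

Lemma scs_pred P X : configs (scs P) X -> X !=set0 ->
  exists2 e, X e & configs (scs P) (X `\ e).
Proof.
elim: P X => /= [|a P IH|a m P _|P1 IH1 P2 IH2|L P1 IH1 P2 IH2] X.
- by move=> -> [].
- case/configs_preP=> [->[]//|[Xa cX sX]] _.
  have [Y0|/set0P/(IH _ cX)[e Xe cXe]] := eqVneq (TPre a @^-1` X) set0.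
    exists (TAct a) => //; apply/configs_preP; left.
    rewrite predeqE => t; split=> // -[Xt ta].
    case: (sX t Xt) => [|[u tu]] //.
    have : (TPre a @^-1` X) u by rewrite /= -tu.
    by rewrite Y0.
  exists (TPre a e) => //; apply/configs_preP; right; split; first by split.
    suff -> : TPre a @^-1` (X `\ TPre a e) = (TPre a @^-1` X) `\ e by [].
    by rewrite predeqE => t; split=> -[? H]; split=> // E; apply: H; [rewrite E|case: E].
  by move=> t [/sX].
- by move=> -> [].
- case/configs_sumP=> -[cX sX] [e0 Xe0].
  + have [u eu] := sX _ Xe0.
    have [|e Xe cXe] := IH1 _ cX; first by exists u; rewrite /= -eu.
    exists (TPlusL e) => //; apply/configs_sumP; left; split; last by move=> t [/sX].
    suff -> : @TPlusL A @^-1` (X `\ TPlusL e) = (@TPlusL A @^-1` X) `\ e by [].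
    by rewrite predeqE => t; split=> -[? H]; split=> // E; apply: H; [rewrite E|case: E].
  + have [u eu] := sX _ Xe0.
    have [|e Xe cXe] := IH2 _ cX; first by exists u; rewrite /= -eu.
    exists (TPlusR e) => //; apply/configs_sumP; right; split; last by move=> t [/sX].
    suff -> : @TPlusR A @^-1` (X `\ TPlusR e) = (@TPlusR A @^-1` X) `\ e by [].
    by rewrite predeqE => t; split=> -[? H]; split=> // E; apply: H; [rewrite E|case: E].
- by move=> cX; apply: par_config_pred => //;
    [exact: scs_stable|exact: scs_stable|exact: scs0|exact: scs0].
Qed.

End Configurations.

(** * Processes as marked configurations *)

Section Markings.
Variable A : countType.
Implicit Types (P Q : proc A) (t u e : pterm A) (m xi : mark A) (a : A) (L : set A).
Implicit Types (X Y : set (pterm A)) (s : seq (pterm A)).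
Implicit Types (W : pterm A -> set (mark A)).

Definition mproj_1 L W t : set (mark A) :=
  [set m | W (TParL L t) m \/ exists u, W (TSync L t u) m].

Definition mproj_2 L W t : set (mark A) :=
  [set m | W (TParR L t) m \/ exists u, W (TSync L u t) m].

Definition supp W : set (pterm A) := [set t | exists m, W t m].

Definition madd W t xi u : set (mark A) := [set m | W u m \/ u = t /\ m = xi].

Lemma supp_mproj_1 L W : supp (mproj_1 L W) = proj_1 L (supp W).
Proof.
rewrite predeqE => t; split=> [[m [H|[u H]]]|[[m H]|[u [m H]]]].
- by left; exists m.
- by right; exists u, m.
- by exists m; left.
- by exists m; right; exists u.
Qed.

Lemma supp_mproj_2 L W : supp (mproj_2 L W) = proj_2 L (supp W).
Proof.
rewrite predeqE => t; split=> [[m [H|[u H]]]|[[m H]|[u [m H]]]].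
- by left; exists m.
- by right; exists u, m.
- by exists m; left.
- by exists m; right; exists u.
Qed.

(* [W] gives the superscripts left in [P] by each of the events executed so far;
   the pairing of the events of the two sides of a parallel composition is
   recorded by [W] rather than by [P]. *)
Fixpoint marking P W : Prop :=
  match P with
  | Null => True
  | Pre a P' => [/\ initial P', ~ supp W (TAct a) & marking P' (fun t => W (TPre a t))]
  | Past a xi P' => W (TAct a) = [set xi] /\ marking P' (fun t => W (TPre a t))
  | Sum P1 P2 => marking P1 (fun t => W (TPlusL t)) /\
                 marking P2 (fun t => W (TPlusR t))
  | Par L P1 P2 => marking P1 (mproj_1 L W) /\ marking P2 (mproj_2 L W)
  end.

Lemma marking_initial P W : initial P -> supp W = set0 -> marking P W.
Proof.
have sub (f : pterm A -> pterm A) V : supp V = set0 -> supp (fun t => V (f t)) = set0.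
  by rewrite !predeqE => V0 t; split=> // H; apply/(V0 (f t)).
elim: P W => //= [a P IH|P1 IH1 P2 IH2|L P1 IH1 P2 IH2] W => [iP W0|[i1 i2] W0|[i1 i2] W0].
- by split=> //; [rewrite W0|apply: IH => //; apply: sub].
- by split; [apply: IH1|apply: IH2] => //; apply: sub.
- by split; [apply: IH1|apply: IH2] => //;
    rewrite ?supp_mproj_1 ?supp_mproj_2 W0 ?proj_10 ?proj_20.
Qed.

Lemma marking_supp0 P W : marking P W -> supp W = set0 -> initial P.
Proof.
have sub (f : pterm A -> pterm A) V : supp V = set0 -> supp (fun t => V (f t)) = set0.
  by rewrite !predeqE => V0 t; split=> // H; apply/(V0 (f t)).
elim: P W => //= [a P IH|a m P _|P1 IH1 P2 IH2|L P1 IH1 P2 IH2] W.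
- by case.
- by move=> [Wa _]; rewrite predeqE => /(_ (TAct a))[+ _]; apply; exists m; rewrite Wa.
- by move=> [m1 m2] W0; split; [apply: IH1 m1 _|apply: IH2 m2 _]; apply: sub.
- by move=> [m1 m2] W0; split; [apply: IH1 m1 _|apply: IH2 m2 _];
    rewrite ?supp_mproj_1 ?supp_mproj_2 W0 ?proj_10 ?proj_20.
Qed.

Lemma marking_config0 P W : initial P -> marking P W ->
  configs (scs (toinitial P)) (supp W) -> supp W = set0.
Proof.
elim: P W => //= [a P IH|P1 IH1 P2 IH2|L P1 IH1 P2 IH2] W.
- by move=> _ [_ na _] /configs_preP[|[]].
- move=> [i1 i2] [m1 m2] /configs_sumP[[c1 s1]|[c2 s2]].
  + have E := IH1 _ i1 m1 c1; rewrite predeqE => t; split=> // Wt.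
    have [u tu] := s1 _ Wt; rewrite tu in Wt.
    have : supp (fun t => W (TPlusL t)) u by exact: Wt.
    by rewrite E.
  + have E := IH2 _ i2 m2 c2; rewrite predeqE => t; split=> // Wt.
    have [u tu] := s2 _ Wt; rewrite tu in Wt.
    have : supp (fun t => W (TPlusR t)) u by exact: Wt.
    by rewrite E.
- move=> [i1 i2] [m1 m2] [[sW _] [c1 c2] _ _].
  have E1 : proj_1 L (supp W) = set0.
    by rewrite -supp_mproj_1; apply: IH1 => //; rewrite supp_mproj_1.
  have E2 : proj_2 L (supp W) = set0.
    by rewrite -supp_mproj_2; apply: IH2 => //; rewrite supp_mproj_2.
  rewrite predeqE => e; split=> // We.
  case: (sW _ We) => [[[t _ te]|[t _ te]]|[t [u [te _ _ _]]]].
  + by have : proj_1 L (supp W) t; [left; rewrite te|rewrite E1].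
  + by have : proj_2 L (supp W) t; [left; rewrite te|rewrite E2].
  + by have : proj_1 L (supp W) t; [right; exists u; rewrite -te|rewrite E1].
Qed.

Lemma marking_inj P Q W : marking P W -> marking Q W ->
  toinitial P = toinitial Q -> P = Q.
Proof.
elim: P Q W => [|a P IH|a m P IH|P1 IH1 P2 IH2|L P1 IH1 P2 IH2]
  [|b Q|b n Q|Q1 Q2|K Q1 Q2] W //=.
- by move=> [iP _ _] [iQ _ _] [-> E]; rewrite -(toinitial_id iP) E toinitial_id.
- move=> [_ nWa _] [Wb _] [ab _]; case: nWa; exists n; by rewrite ab Wb.
- move=> [Wa _] [_ nWb _] [ab _]; case: nWb; exists m; by rewrite -ab Wa.
- move=> [Wa mP] [Wb mQ] [ab E]; subst b; rewrite (IH _ _ mP mQ E).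
  suff -> : m = n by [].
  by have : W (TAct a) m; rewrite Wa // -Wa Wb.
- by move=> [p1 p2] [q1 q2] [E1 E2]; rewrite (IH1 _ _ p1 q1 E1) (IH2 _ _ p2 q2 E2).
- move=> [p1 p2] [q1 q2] [LK E1 E2]; subst K.
  by rewrite (IH1 _ _ p1 q1 E1) (IH2 _ _ p2 q2 E2).
Qed.

Lemma madd_comp (f : pterm A -> pterm A) W t xi : injective f ->
  (fun u => madd W (f t) xi (f u)) = madd (fun u => W (f u)) t xi.
Proof.
move=> fI; rewrite funeqE => u; rewrite predeqE => m.
by split=> -[|[E ->]]; by [left|right; split=> //; apply: fI|right; rewrite E].
Qed.

Lemma madd_comp0 (f : pterm A -> pterm A) W t xi : (forall u, f u <> t) ->
  (fun u => madd W t xi (f u)) = (fun u => W (f u)).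
Proof.
move=> ft; rewrite funeqE => u; rewrite predeqE => m.
by split=> [[|[/ft]]|]; [|by []|left].
Qed.

Lemma mproj_1_parl L W t xi :
  mproj_1 L (madd W (TParL L t) xi) = madd (mproj_1 L W) t xi.
Proof.
rewrite funeqE => u; rewrite predeqE => m; split.
  by move=> [[H|[[->] ->]]|[v [H|[]]]]; [left; left|right|left; right; exists v|].
by move=> [[H|[v H]]|[-> ->]]; [left; left|right; exists v; left|left; right].
Qed.

Lemma mproj_2_parl L W t xi : mproj_2 L (madd W (TParL L t) xi) = mproj_2 L W.
Proof.
rewrite funeqE => u; rewrite predeqE => m; split.
  by move=> [[H|[]]|[v [H|[]]]] //; [left|right; exists v].
by move=> [H|[v H]]; [left; left|right; exists v; left].
Qed.

Lemma mproj_2_parr L W t xi :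
  mproj_2 L (madd W (TParR L t) xi) = madd (mproj_2 L W) t xi.
Proof.
rewrite funeqE => u; rewrite predeqE => m; split.
  by move=> [[H|[[->] ->]]|[v [H|[]]]]; [left; left|right|left; right; exists v|].
by move=> [[H|[v H]]|[-> ->]]; [left; left|right; exists v; left|left; right].
Qed.

Lemma mproj_1_parr L W t xi : mproj_1 L (madd W (TParR L t) xi) = mproj_1 L W.
Proof.
rewrite funeqE => u; rewrite predeqE => m; split.
  by move=> [[H|[]]|[v [H|[]]]] //; [left|right; exists v].
by move=> [H|[v H]]; [left; left|right; exists v; left].
Qed.

Lemma mproj_1_sync L W t1 t2 xi :
  mproj_1 L (madd W (TSync L t1 t2) xi) = madd (mproj_1 L W) t1 xi.
Proof.
rewrite funeqE => u; rewrite predeqE => m; split.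
  by move=> [[H|[]]|[v [H|[[-> _] ->]]]] //; [left; left|left; right; exists v|right].
by move=> [[H|[v H]]|[-> ->]]; [left; left|right; exists v; left|right; exists t2; right].
Qed.

Lemma mproj_2_sync L W t1 t2 xi :
  mproj_2 L (madd W (TSync L t1 t2) xi) = madd (mproj_2 L W) t2 xi.
Proof.
rewrite funeqE => u; rewrite predeqE => m; split.
  by move=> [[H|[]]|[v [H|[[_ ->] ->]]]] //; [left; left|left; right; exists v|right].
by move=> [[H|[v H]]|[-> ->]]; [left; left|right; exists v; left|right; exists t1; right].
Qed.

Lemma marking_fire P t xi P' : fire P t xi P' ->
  forall W, marking P W -> marking P' (madd W t xi).
Proof.
elim=> {P t xi P'} /=.
- move=> a P xi _ W [_ na mP]; rewrite madd_comp0 //; split=> //.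
  rewrite predeqE => m; split=> [[Wm|[_ ->]//]|->]; last by right.
  by case: na; exists m.
- move=> a m P t xi P' _ IH W [Wa mP]; split.
    by rewrite -Wa predeqE => n; split=> [[|[]]|] //; left.
  by rewrite (@madd_comp (TPre a)) => [|? ? []//]; exact: IH.
- move=> P1 P2 t xi P1' _ IH _ W [m1 m2].
  rewrite (@madd_comp0 (@TPlusR A)) // (@madd_comp (@TPlusL A)) => [|? ? []//].
  by split=> //; exact: IH.
- move=> P1 P2 t xi P2' _ IH _ W [m1 m2].
  rewrite (@madd_comp0 (@TPlusL A)) // (@madd_comp (@TPlusR A)) => [|? ? []//].
  by split=> //; exact: IH.
- move=> L P1 P2 t a xi P1' _ IH _ _ W [m1 m2].
  by rewrite mproj_1_parl mproj_2_parl; split=> //; exact: IH.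
- move=> L P1 P2 t a xi P2' _ IH _ _ W [m1 m2].
  by rewrite mproj_1_parr mproj_2_parr; split=> //; exact: IH.
- move=> L P1 P2 t1 t2 a xi P1' P2' _ IH1 _ IH2 _ _ _ W [m1 m2].
  by rewrite mproj_1_sync mproj_2_sync; split; [exact: IH1|exact: IH2].
Qed.

Lemma preimage_add (f : pterm A -> pterm A) X t : injective f ->
  f @^-1` (X `|` [set f t]) = f @^-1` X `|` [set t].
Proof.
by move=> fI; rewrite predeqE => u; split=> [[|/fI->]|[|->]]; by [left|right].
Qed.

Lemma fire_config P t xi P' : fire P t xi P' -> forall W, marking P W ->
  configs (scs (toinitial P)) (supp W) ->
  ~ supp W t /\ configs (scs (toinitial P)) (supp W `|` [set t]).
Proof.
elim=> {P t xi P'}.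
- move=> a P xi iP W [_ na mP] /configs_preP[W0|[//]]; split=> //.
  rewrite W0 set0U; apply/configs_preP; right; split=> //; last by move=> t ->; left.
  suff -> : TPre a @^-1` [set TAct a] = set0 by exact: scs0.
  by rewrite predeqE.
- move=> a m P t xi P' _ IH W [Wa mP] /configs_preP[W0|[_ cW sW]].
    have : supp W (TAct a) by exists m; rewrite Wa.
    by rewrite W0.
  have [nt cWt] := IH _ mP cW; split=> //; apply/configs_preP; right; split.
  + by left; exists m; rewrite Wa.
  + by rewrite preimage_add => [|? ? []//].
  + by move=> u [/sW//|->]; right; exists t.
- move=> P1 P2 t xi P1' _ IH i2 W [m1 m2] cW.
  have [c1 s1] : configs (scs (toinitial P1)) (@TPlusL A @^-1` supp W) /\
      forall u, supp W u -> exists v, u = TPlusL v.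
    case/configs_sumP: cW => // -[c2 s2].
    have E := marking_config0 i2 m2 c2.
    have W0 : supp W = set0.
      rewrite predeqE => u; split=> // Wu; have [v uv] := s2 _ Wu.
      rewrite uv in Wu; have : supp (fun t => W (TPlusR t)) v by exact: Wu.
      by rewrite E.
    by rewrite W0; split=> //; exact: scs0.
  have [nt cWt] := IH _ m1 c1; split=> //; apply/configs_sumP; left; split.
  + by rewrite preimage_add => [|? ? []//].
  + by move=> u [/s1//|->]; exists t.
- move=> P1 P2 t xi P2' _ IH i1 W [m1 m2] cW.
  have [c2 s2] : configs (scs (toinitial P2)) (@TPlusR A @^-1` supp W) /\
      forall u, supp W u -> exists v, u = TPlusR v.
    case/configs_sumP: cW => // -[c1 s1].
    have E := marking_config0 i1 m1 c1.
    have W0 : supp W = set0.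
      rewrite predeqE => u; split=> // Wu; have [v uv] := s1 _ Wu.
      rewrite uv in Wu; have : supp (fun t => W (TPlusL t)) v by exact: Wu.
      by rewrite E.
    by rewrite W0; split=> //; exact: scs0.
  have [nt cWt] := IH _ m2 c2; split=> //; apply/configs_sumP; right; split.
  + by rewrite preimage_add => [|? ? []//].
  + by move=> u [/s2//|->]; exists t.
- move=> L P1 P2 t a xi P1' _ IH ta La W [m1 m2] cW.
  have [_ [c1 c2] _ _] := cW.
  have := IH _ m1; rewrite supp_mproj_1 => /(_ c1)[nt ct].
  apply: (par_config_add cW); rewrite ?proj_1_parl ?proj_2_parl ?setU0 //.
  + by apply: par_events_parl ta La; apply: scs_events ct _ _; right.
  + by move=> u ->.
- move=> L P1 P2 t a xi P2' _ IH ta La W [m1 m2] cW.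
  have [_ [c1 c2] _ _] := cW.
  have := IH _ m2; rewrite supp_mproj_2 => /(_ c2)[nt ct].
  apply: (par_config_add cW); rewrite ?proj_1_parr ?proj_2_parr ?setU0 //.
  + by apply: par_events_parr ta La; apply: scs_events ct _ _; right.
  + by move=> u ->.
- move=> L P1 P2 t1 t2 a xi P1' P2' _ IH1 _ IH2 t1a t2a La W [m1 m2] cW.
  have [_ [c1 c2] _ _] := cW.
  have := IH1 _ m1; rewrite supp_mproj_1 => /(_ c1)[n1 ct1].
  have := IH2 _ m2; rewrite supp_mproj_2 => /(_ c2)[n2 ct2].
  apply: (par_config_add cW); rewrite ?proj_1_sync ?proj_2_sync //.
  + by apply: par_events_sync t1a t2a La;
      [apply: scs_events ct1 _ _|apply: scs_events ct2 _ _]; right.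
  + by move=> u ->.
  + by move=> u ->.
Qed.

Lemma config_trans P t W : marking P W -> configs (scs (toinitial P)) (supp W) ->
  configs (scs (toinitial P)) (supp W `|` [set t]) -> ~ supp W t ->
  exists P', trans P t P'.
Proof.
elim: P t W => [|a P IH|a m P IH|P1 IH1 P2 IH2|L P1 IH1 P2 IH2] t W.
- move=> _ _ /= H; have : (supp W `|` [set t]) t by right.
  by rewrite H.
- move=> [iP na mP] cW /configs_preP[W0|[Wa _ _]] nt.
    have : (supp W `|` [set t]) t by right.
    by rewrite W0.
  case: Wa => // <-; exists (Past a MEps P); exact: tr_actf.
- move=> [Wa mP] /configs_preP cW /configs_preP cWt nt.
  have Wta : supp W (TAct a) by exists m; rewrite Wa.
  case: cW => [W0|[_ cW sW]]; first by move: Wta; rewrite W0.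
  case: cWt => [W0|[_ cWt sWt]].
    by have : (supp W `|` [set t]) t; [right|rewrite W0].
  have [ta|[u tu]] := sWt t (or_intror erefl); first by case: nt; rewrite ta.
  subst t; rewrite preimage_add in cWt => [|? ? []//].
  by have [P' tr] := IH _ _ mP cW cWt nt; exists (Past a m P'); exact: tr_actp.
- move=> [m1 m2] /= cW /configs_sumP cWt nt.
  case: cWt => -[cWt sWt].
  + have [u tu] := sWt t (or_intror erefl); subst t.
    rewrite preimage_add in cWt => [|? ? []//].
    have R0 : supp (fun t => W (TPlusR t)) = set0.
      by rewrite predeqE => v; split=> // Wv; have [] := sWt (TPlusR v) (or_introl Wv).
    have c1 : configs (scs (toinitial P1)) (supp (fun t => W (TPlusL t))).
      case/configs_sumP: cW => -[c1 s1] //.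
      suff -> : supp (fun t => W (TPlusL t)) = set0 by exact: scs0.
      by rewrite predeqE => v; split=> // Wv; have [] := s1 (TPlusL v) Wv.
    have [P1' tr] := IH1 _ _ m1 c1 cWt nt.
    exists (Sum P1' P2); apply: tr_chol tr _; exact: marking_supp0 m2 R0.
  + have [u tu] := sWt t (or_intror erefl); subst t.
    rewrite preimage_add in cWt => [|? ? []//].
    have L0 : supp (fun t => W (TPlusL t)) = set0.
      by rewrite predeqE => v; split=> // Wv; have [] := sWt (TPlusL v) (or_introl Wv).
    have c2 : configs (scs (toinitial P2)) (supp (fun t => W (TPlusR t))).
      case/configs_sumP: cW => -[c2 s2] //.
      suff -> : supp (fun t => W (TPlusR t)) = set0 by exact: scs0.
      by rewrite predeqE => v; split=> // Wv; have [] := s2 (TPlusR v) Wv.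
    have [P2' tr] := IH2 _ _ m2 c2 cWt nt.
    exists (Sum P1 P2'); apply: tr_chor tr _; exact: marking_supp0 m1 L0.
- move=> [m1 m2] cW cWt nt.
  have [_ [c1 c2] _ _] := cW; have [[sWt _] [d1 d2] _ _] := cWt.
  have [n1 n2] := par_config_new cWt nt.
  move: (IH1 ^~ (mproj_1 L W)) (IH2 ^~ (mproj_2 L W)) => {}IH1 {}IH2.
  rewrite supp_mproj_1 in IH1; rewrite supp_mproj_2 in IH2.
  rewrite proj_1U in d1; rewrite proj_2U in d2.
  case: (sWt t (or_intror erefl)) => [[[u [_ [a [ua La]]] ut]|[u [_ [a [ua La]]] ut]]|
      [u [v [tuv _ _ [a [ua va La]]]]]]; subst t.
  + rewrite proj_1_parl in n1 d1.
    have [P1' tr] := IH1 u m1 c1 d1 (n1 _ erefl).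
    by exists (Par L P1' P2); exact: tr_parl tr ua La.
  + rewrite proj_2_parr in n2 d2.
    have [P2' tr] := IH2 u m2 c2 d2 (n2 _ erefl).
    by exists (Par L P1 P2'); exact: tr_parr tr ua La.
  + rewrite proj_1_sync in n1 d1; rewrite proj_2_sync in n2 d2.
    have [P1' tr1] := IH1 u m1 c1 d1 (n1 _ erefl).
    have [P2' tr2] := IH2 v m2 c2 d2 (n2 _ erefl).
    have [Q1 e1] := fire_enr_ex (trans_fire tr1) (MSync L u v).
    have [Q2 e2] := fire_enr_ex (trans_fire tr2) (MSync L u v).
    by exists (Par L Q1 Q2); apply: tr_syn tr1 tr2 ua va La _; exact: enr_sync.
Qed.

Definition run_marking X t : set (mark A) := [set m | X t /\ m = mk t].

Lemma supp_run_marking X : supp (run_marking X) = X.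
Proof. by rewrite predeqE => t; split=> [[m []]//|Xt]; exists (mk t). Qed.

Lemma reachable_config P : reachable P ->
  marking P (run_marking (evt P)) /\ configs (scs (toinitial P)) (evt P).
Proof.
move=> [P0 [s [iP st]]].
have : marking P0 (run_marking (evt P0)) /\ configs (scs (toinitial P0)) (evt P0).
  have E : evt P0 = set0 by rewrite predeqE => t; split=> // /(evt_initial iP).
  rewrite E; split; last exact: scs0.
  by apply: marking_initial => //; rewrite supp_run_marking.
elim: st => {P0 s P iP} // P t P' s Q tr _ IH [mP cP]; apply: IH.
have F := trans_fire tr.
rewrite (evt_trans tr) (fire_toinitial F); split.
  suff -> : run_marking (evt P `|` [set t]) = madd (run_marking (evt P)) t (mk t).
    exact: marking_fire F _ mP.
  rewrite funeqE => u; rewrite predeqE => m; split.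
    by move=> [[Pu|->] ->]; [left|right].
  by move=> [[? ->]|[-> ->]]; split=> //; [left|right].
have [] := fire_config F mP; rewrite supp_run_marking => //.
Qed.

Lemma reachable_trans_new P t P' : reachable P -> trans P t P' -> ~ evt P t.
Proof.
move=> /reachable_config[mP cP] /trans_fire F.
by have [] := fire_config F mP; rewrite supp_run_marking.
Qed.

Lemma reachable_config_trans P t : reachable P ->
  configs (scs (toinitial P)) (evt P `|` [set t]) -> ~ evt P t ->
  exists P', trans P t P'.
Proof.
move=> /reachable_config[mP cP] cPt nt.
by apply: (config_trans mP); rewrite supp_run_marking.
Qed.

Lemma reachable_inj P Q : reachable P -> reachable Q ->
  toinitial P = toinitial Q -> evt P = evt Q -> P = Q.
Proof.
move=> /reachable_config[mP _] /reachable_config[mQ _] E EX.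
by apply: marking_inj mP _ E; rewrite EX.
Qed.

Lemma config_reachable P X : initial P -> configs (scs P) X ->
  exists Q, [/\ reachable Q, toinitial Q = P & evt Q = X].
Proof.
move=> iP cX; have [l] := finite_list (scs_finite cX).
move: (leqnn (size l)); move: {2}(size l) => n.
elim: n X l cX => [|n IH] X l cX.
  rewrite leqn0 => /nilP -> X0; exists P; split; [|exact: toinitial_id|].
    by exists P, [::]; split=> //; exact: steps_nil.
  by rewrite predeqE => t; split=> [/(evt_initial iP)|/X0].
have [X0 _ _|/set0P nX ln Hl] := eqVneq X set0.
  by apply: (IH X [::]) => //; rewrite X0.
have [e Xe cXe] := scs_pred cX nX.
have [l1 [l2 El]] := List.in_split _ _ (Hl _ Xe).
have [|t [Xt te]|Q [rQ tQ eQ]] := IH (X `\ e) (l1 ++ l2) cXe.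
- by move: ln; rewrite El !size_cat /= addnS.
- have := Hl _ Xt; rewrite El => H; apply: List.in_or_app.
  case: (List.in_app_or _ _ _ H) => [|[et|]]; [by left|by case: te|by right].
have EX : evt Q `|` [set e] = X.
  rewrite eQ predeqE => t; split=> [[[]//|->//]|Xt].
  by have [->|te] := pselect (t = e); [right|left].
have [||Q' tr] := @reachable_config_trans Q e rQ.
- by rewrite tQ EX.
- by rewrite eQ => -[_]; apply.
exists Q'; split; first exact: reachable_trans rQ tr.
  by rewrite (fire_toinitial (trans_fire tr)).
by rewrite (evt_trans tr).
Qed.

Lemma steps_subproc P s Q : steps P s Q -> forall a m R, subproc (Past a m R) P ->
  exists2 R', subproc (Past a m R') Q & toinitial R' = toinitial R.
Proof.
elim=> [{}P a m R H|{}P t P' {}s {}Q /trans_fire F _ IH a m R].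
  by exists R.
by move=> /(fire_subproc F)[R1 /IH[R2 H E2] E1]; exists R2; rewrite // E2.
Qed.

Lemma evt_subproc P t a : reachable P -> evt P t -> act t = Some a ->
  exists m R, subproc (Past a m R) P /\ apt a m R P t.
Proof.
move=> rP; have [s st] := reachable_steps rP.
rewrite -(steps_labels (initial_toinitial P) st) => ts ta.
move: (toinitial P) st => P0 st; clear rP.
elim: st ts => {P0 s P} // P u P' s Q tr st IH /= [ut|/IH//].
rewrite ut in tr; have [R [iR s1 s2]] := fire_act (trans_fire tr) ta.
have [R' s3] := steps_subproc st s2; rewrite (toinitial_id iR) => E.
by exists (mk t), R'; split=> //; split=> //; exists P, P'; rewrite E.
Qed.

Lemma subproc_evt P a m R : reachable P -> subproc (Past a m R) P ->
  exists2 t, evt P t & act t = Some a.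
Proof.
move=> [P0 [s [iP st]]].
have : (exists R, subproc (Past a m R) P0) -> exists2 t, evt P0 t & act t = Some a.
  by move=> [R' /(subproc_initial iP)].
elim: st R => {P0 s P iP} [P R H PR|P t P' s Q tr _ IH R H]; first by apply: H; exists R.
apply: (IH R) => -[R'] /(subproc_fire (trans_fire tr))[/H[u Pu ua]|[ta _]].
  by exists u => //; rewrite (evt_trans tr); left.
by exists t => //; rewrite (evt_trans tr); right.
Qed.

End Markings.

(** * Satisfaction *)

Section Logic.
Variables A Id : countType.
Implicit Types (phi : form A Id) (rho : env A Id) (P : proc A).
Implicit Types (C : cstruct A) (X : set (pterm A)).

Lemma ctransE C X e X' : ctrans C X e X' <->
  [/\ configs C X, configs C X', ~ X e & X' = X `|` [set e]].
Proof.
split=> [[cX cX' sX d]|[cX cX' nXe E]].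
  have [X'e nXe] : (X' `\` X) e by rewrite d.
  split=> //; rewrite predeqE => t; split=> [X't|[/sX//|->//]].
  have [Xt|nXt] := pselect (X t); [by left|right].
  by rewrite -d.
subst X'; split=> //.
rewrite predeqE => t; split=> [[[Xt|te] nXt]|->] //; by split=> //; right.
Qed.

Lemma csat_permissible C X rho phi : csat C X rho phi -> permissible rho X phi.
Proof. by case: phi => [|?|? ?|? ? ?|? ? ?|? ?] []. Qed.

Lemma psat_permissible P rho phi : psat P rho phi -> permissible rho (conf P) phi.
Proof. by case: phi => [|?|? ?|? ? ?|? ? ?|? ?] []. Qed.

Lemma psat_reachable P rho phi : psat P rho phi -> reachable P.
Proof. by case: phi => [|?|? ?|? ? ?|? ? ?|? ?] []. Qed.

Lemma permissible_eq rho rho' X phi : (forall x, fid phi x -> rho x = rho' x) ->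
  permissible rho X phi -> permissible rho' X phi.
Proof.
move=> E [d p]; split=> [x fx|x e fx]; last by rewrite -E //; exact: p.
by have [e xe] := d x fx; exists e; rewrite -E.
Qed.

Lemma upd_eq rho rho' x e (D : set Id) : (forall y, (D `\ x) y -> rho y = rho' y) ->
  forall y, D y -> upd rho x e y = upd rho' x e y.
Proof. by move=> E y Dy; rewrite /upd; case: eqP => // yx; apply: E. Qed.

Lemma csat_eq C X rho rho' phi : (forall x, fid phi x -> rho x = rho' x) ->
  csat C X rho phi -> csat C X rho' phi.
Proof.
elim: phi X rho rho' => [|phi IH|phi1 IH1 phi2 IH2|x a phi IH|x a phi IH|x phi IH]
  X rho rho' E
  /= [/(permissible_eq E) pm H]; split=> //.
- by move=> H'; apply: H; apply: (IH X rho' rho) H' => x /E.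
- by case: H => H1 H2; split; [apply: (IH1 X rho) H1|apply: (IH2 X rho) H2] => x fx;
    apply: E; [left|right].
- case: H => e [X' [tr ea H]]; exists e, X'; split=> //.
  exact: IH (@upd_eq _ _ _ _ (fid phi) E) H.
- case: H => e [Xe ea H]; exists e; split=> //.
    exact: IH (@upd_eq _ _ _ _ (fid phi) E) H.
- case: H => e [X' [tr xe H]]; exists e, X'; split=> //.
    by rewrite -E //; right.
  by apply: IH H => y fy; apply: E; left.
Qed.

Lemma permissible_fid rho X phi phi' : fid phi' `<=` fid phi ->
  permissible rho X phi -> permissible rho X phi'.
Proof. by move=> s [d p]; split=> [x /s/d//|x e /s]; exact: p. Qed.

Lemma reachable_ctrans P t P' : reachable P -> trans P t P' ->
  ctrans (scs (toinitial P)) (conf P) t (conf P').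
Proof.
move=> rP tr; have rP' := reachable_trans rP tr.
rewrite (conf_evt rP) (conf_evt rP'); apply/ctransE; split.
- by have [] := reachable_config rP.
- have [_] := reachable_config rP'.
  by rewrite (fire_toinitial (trans_fire tr)).
- exact: reachable_trans_new rP tr.
- exact: evt_trans.
Qed.

Lemma ctrans_trans P t X : reachable P ->
  ctrans (scs (toinitial P)) (conf P) t X ->
  exists P', [/\ trans P t P', reachable P', toinitial P' = toinitial P & conf P' = X].
Proof.
move=> rP; rewrite conf_evt // => /ctransE[_ cX nPt XE].
have [|P' tr] := reachable_config_trans rP _ nPt; first by rewrite -XE.
have rP' := reachable_trans rP tr.
exists P'; split=> //; first exact: fire_toinitial (trans_fire tr).
by rewrite conf_evt // (evt_trans tr).
Qed.

Lemma ctrans_trans_rev P t X : reachable P ->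
  ctrans (scs (toinitial P)) X t (conf P) ->
  exists P', [/\ trans P' t P, reachable P', toinitial P' = toinitial P & conf P' = X].
Proof.
move=> rP tr; have [cX _ _ _] := tr.
have [P' [rP' tP' eP']] := config_reachable (initial_toinitial P) cX.
have := tr; rewrite -eP' -(conf_evt rP') -tP' => /(ctrans_trans rP').
move=> [Q [trQ rQ tQ cQ]].
suff <- : Q = P by exists P'; split=> //; rewrite conf_evt.
by apply: (reachable_inj rQ rP); [rewrite tQ|rewrite -(conf_evt rQ) -(conf_evt rP)].
Qed.

Lemma psat_csat phi P rho : reachable P -> permissible rho (conf P) phi ->
  psat P rho phi <-> csat (scs (toinitial P)) (conf P) rho phi.
Proof.
elim: phi P rho => [|phi IH|phi1 IH1 phi2 IH2|x a phi IH|x a phi IH|x phi IH]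
  P rho rP pm /=.
- by split=> -[].
- by split=> [[_ _ H]|[_ H]]; split=> // H'; apply: H; apply/(IH P rho rP pm).
- have p1 : permissible rho (conf P) phi1 by apply: permissible_fid pm => y; left.
  have p2 : permissible rho (conf P) phi2 by apply: permissible_fid pm => y; right.
  split=> [[_ _ [H1 H2]]|[_ [H1 H2]]]; split=> //; split.
  + exact/IH1.
  + exact/IH2.
  + exact/IH1.
  + exact/IH2.
- split=> [[_ _ [t [P' [tr ta H]]]]|[_ [t [X [tr ta H]]]]]; split=> //.
  + exists t, (conf P'); split=> //; first exact: reachable_ctrans.
    rewrite -(fire_toinitial (trans_fire tr)).
    by apply/IH => //; [exact: psat_reachable H|exact: psat_permissible H].
  + have [P' [trP rP' tP' cP']] := ctrans_trans rP tr.
    exists t, P'; split=> //; apply/IH => //; rewrite cP'.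
      exact: csat_permissible H.
    by rewrite tP'.
- split=> [[_ _ [xi [P' [t [sP [_ [_ [_ [_ _ ta _]]]] H]]]]]|[_ [e [Pe ea H]]]]; split=> //.
  + have pmH := psat_permissible H.
    have {}H := (IH _ _ rP pmH).1 H.
    have [fx|nfx] := pselect (fid phi x).
      exists t; split=> //; apply: pmH.2 fx _; by rewrite /upd eqxx.
    have [e Pe ea] := subproc_evt rP sP.
    exists e; split=> //; first by rewrite conf_evt.
    apply: csat_eq H => y fy; rewrite /upd; case: eqP => // yx.
    by case: nfx; rewrite -yx.
  + have Ee : evt P e by rewrite -conf_evt.
    have [m [R [sR aR]]] := evt_subproc rP Ee ea.
    exists m, R, e; split=> //; apply/IH => //; exact: csat_permissible H.
- split=> [[_ _ [t [P' [tr xt H]]]]|[_ [t [X [tr xt H]]]]]; split=> //.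
  + have rP' := psat_reachable H.
    exists t, (conf P'); rewrite (fire_toinitial (trans_fire tr)); split=> //.
      exact: reachable_ctrans.
    by apply/IH => //; exact: psat_permissible H.
  + have [P' [trP rP' tP' cP']] := ctrans_trans_rev rP tr.
    exists t, P'; split=> //; apply/IH => //; rewrite cP'.
      exact: csat_permissible H.
    by rewrite tP'.
Qed.

End Logic.

Theorem theorem5p1 (A Id : countType) (tau : A) (P : proc A)
    (hP : reachable P) (phi : form A Id) (rho : env A Id)
    (hrho : permissible rho (conf P) phi) :
  psat P rho phi <-> csat (denot P).1 (denot P).2 rho phi.
Proof. exact: psat_csat. Qed.
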